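(* Suppose that the nested fractal $\mathcal K$ satisfies Property (P). Then there exist constants $C>0$ and $A\ge1$, depending only on $\mathcal K$, such that for every $f\in\mathcal D(\mathcal E)$, every $x_0\in\mathcal K\setminus V^{(\infty)}$ and every $r>0$, with $B=B(x_0,r)=\{y\in\mathcal K:\rho(x_0,y)\le r\}$ and $f_B=\frac1{\mu(B)}\int_Bf\,d\mu$, $$\frac1{\mu(B)}\int_B|f-f_B|\,d\mu\le C\,r^{\frac{d_w}{2}}\left(\frac1{r^d}\int_{B(x_0,Ar)}\langle\nabla f,Z\,\nabla f\rangle\,d\nu\right)^{1/2}.$$
   Context: Nested fractal. Let $\phi_1,\dots,\phi_M$ ($M\ge2$) be similitudes of $\mathbb R^N$ with common scaling factor $L>1$, i.e. $|\phi_i(x)-\phi_i(y)|=L^{-1}|x-y|$. For $A\subset\mathbb R^N$ put $\Phi(A)=\bigcup_{i=1}^M\phi_i(A)$, and let $\Phi^m$ be its $m$-fold iterate. $\mathcal K$ is the unique nonempty compact set with $\mathcal K=\Phi(\mathcal K)$; it is normalized so that $\mathrm{diam}\,\mathcal K=1$. Let $v_i$ be the fixed point of $\phi_i$; $v_i$ is essential if there are another fixed point $v_j\ne v_i$ and $k,l$ with $\phi_k(v_i)=\phi_l(v_j)$. $V^{(0)}$ is the set of essential fixed points, $\#V^{(0)}\ge2$, $V^{(m)}=\Phi^m(V^{(0)})$, $V^{(\infty)}=\bigcup_{m\ge0}V^{(m)}$. $\mathcal W_m=\{1,\dots,M\}^m$; for $w=(w_1,\dots,w_m)\in\mathcal W_m$,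 $\phi_w=\phi_{w_1}\circ\cdots\circ\phi_{w_m}$ and $\mathcal K_w=\phi_w(\mathcal K)$. The sets $\mathcal K_w$, $w\in\mathcal W_m$, are the $m$-simplices (the $0$-simplex is $\mathcal K$), $\mathcal T_m$ is their collection, and $V(\mathcal K_w)=\phi_w(V^{(0)})$. $\mathcal K$ is a nested fractal, meaning: (open set condition) there is a nonempty open $U$ with $\Phi(U)\subset U$ and $\phi_i(U)\cap\phi_j(U)=\emptyset$ for $i\ne j$; (nesting) $S\cap T=V(S)\cap V(T)$ for distinct $S,T\in\mathcal T_m$, $m\ge1$; (connectivity) the graph on $V^{(1)}$ joining points of a common $\phi_i(V^{(0)})$ is connected; (symmetry) for $x\neq y$ in $V^{(0)}$, the reflection $R_{x,y}$ in the hyperplane bisecting $[x,y]$ maps each $\phi_i(V^{(0)})$ onto some $\phi_j(V^{(0)})$. $d=\log M/\log L$ is the Hausdorff dimension of $\mathcal K$, and $\mu$ is the $d$-dimensional Hausdorff measure on $\mathcal K$ normalized by $\mu(\mathcal K)=1$. $\rho(x,y)$ is the Euclidean distance. Simplices. For $x\in\mathcal K\setminus V^{(\infty)}$, $\Delta_m(x)$ is the unique $m$-simplex containing $x$. For $\Delta\in\mathcal T_m$, $\Delta^*$ is the union of $\Delta$ and all $m$-simplices adjacent to (i.e. intersecting) $\Delta$; $\Delta_m^*(x)=(\Delta_m(x))^*$. Property (P): there exists $\alpha>0$ such that for all $n=1,2,\dots$ and all $x,y\in\mathcal K\setminus V^{(\infty)}$ with $y\in\Delta_n^*(x)\setminus\Delta_{n+1}^*(x)$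 one has $\rho(x,y)\ge\alpha L^{-n}$. Harmonic structure and Dirichlet form. A conductivity matrix is a symmetric real $A=[a_{x,y}]_{x,y\in V^{(0)}}$ with nonnegative off-diagonal entries and zero row sums; $\mathcal E^{(0)}_A(f,f)=\frac12\sum_{x,y}a_{x,y}(f(x)-f(y))^2$. It is known that there are a unique number $\varrho>1$ and a unique, up to a multiplicative constant, irreducible $A$ invariant under the group generated by the $R_{x,y}$, $x\ne y\in V^{(0)}$, such that for all $f:V^{(0)}\to\mathbb R$, $\inf\{\sum_{i=1}^M\mathcal E^{(0)}_A(g\circ\phi_i,g\circ\phi_i): g:V^{(1)}\to\mathbb R,\ g|_{V^{(0)}}=f\}=\varrho^{-1}\mathcal E^{(0)}_A(f,f)$. Fix such $A$, write $\mathcal E^{(0)}=\mathcal E^{(0)}_A$ (this matrix is unrelated to the constant $A$ in the claim). The walk dimension is $d_w=\log(M\varrho)/\log L$, so $\varrho=L^{d_w-d}$. For $f\in C(\mathcal K)$, $\mathcal E^{(m)}(f,f)=\varrho^m\sum_{w\in\mathcal W_m}\mathcal E^{(0)}(f\circ\phi_w,f\circ\phi_w)$ is nondecreasing in $m$; $\mathcal D(\mathcal E)=\{f\in C(\mathcal K):\sup_m\mathcal E^{(m)}(f,f)<\infty\}$ and $\mathcal E(f,f)=\lim_m\mathcal E^{(m)}(f,f)$. Kusuoka measure and gradient. For $f:V^{(0)}\to\mathbb R$ (or $f\in C(\mathcal K)$, restricted to $V^{(0)}$), $Hf$ is the unique minimizer of $\mathcal E(g,g)$ among $g\in\mathcal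 D(\mathcal E)$ with $g=f$ on $V^{(0)}$; such functions are called harmonic. $\mathcal H$ is the space of harmonic functions with norm $\|h\|_{\mathcal H}^2=\mathcal E(h,h)+(\sum_{x\in V^{(0)}}h(x))^2$; $\widetilde{\mathcal H}$ is the orthogonal complement of the constants in $\mathcal H$, with norm $\|h\|^2=\mathcal E(h,h)$ and scalar product $\langle\cdot,\cdot\rangle$; $\widetilde P:\mathcal H\to\widetilde{\mathcal H}$ is the orthogonal projection. $\widetilde M_ih=\widetilde P(h\circ\phi_i)$ for $h\in\widetilde{\mathcal H}$, and $\widetilde M_w=\widetilde M_{w_m}\circ\cdots\circ\widetilde M_{w_1}$. The harmonic structure is assumed nondegenerate: all $\widetilde M_i$ are invertible. The Kusuoka measure $\nu$ is the Borel measure on $\mathcal K$ (without atoms) with $\nu(\mathcal K_w)=\varrho^m\,\mathrm{Tr}(\widetilde M_w^*\widetilde M_w)$, $w\in\mathcal W_m$. For $x\in\mathcal K\setminus V^{(\infty)}$ with unique address $w=w_1w_2\cdots$ and $[w]_m=(w_1,\dots,w_m)$, put $Z_m(x)=\widetilde M_{[w]_m}^*\widetilde M_{[w]_m}/\mathrm{Tr}(\widetilde M_{[w]_m}^*\widetilde M_{[w]_m})$; then $Z=\lim_mZ_m$ exists $\nu$-a.e. Put $\nabla_mf(x)=\widetilde M_{[w]_m}^{-1}\widetilde PH(f\circ\phi_{[w]_m})\in\widetilde{\mathcal H}$. For $f\in\mathcal D(\mathcal E)$, $\nabla f:\mathcal K\to\widetilde{\mathcal H}$ denotes a measurable map, defined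 $\nu$-a.e., which is the limit of $\nabla_mf$ in the seminorm $F\mapsto(\int_{\mathcal K}\langle F,ZF\rangle\,d\nu)^{1/2}$; it satisfies $\mathcal E(f,f)=\int_{\mathcal K}\langle\nabla f,Z\nabla f\rangle\,d\nu$ (the function $\langle\nabla f,Z\nabla f\rangle$ is determined $\nu$-a.e.). *)

(* Defs.v *)
From Stdlib Require Import Relation_Operators.
From mathcomp Require Import all_boot all_order all_algebra.
From mathcomp Require Import all_classical all_reals all_analysis.
Import Order.TTheory GRing.Theory Num.Theory.
Import numFieldNormedType.Exports.

Set Implicit Arguments.
Unset Strict Implicit.
Unset Printing Implicit Defensive.

Local Open Scope classical_set_scope.
Local Open Scope ring_scope.

(* The norm of 'rV[R]_N in the library is the sup norm; it induces the usual
   topology, but distances, diameters, reflections and balls below are all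
   Euclidean. *)
Section Euclidean.
Variables (R : realType) (N : nat).
Implicit Types (x y z : 'rV[R]_N) (A : set 'rV[R]_N).

Definition dot x y : R := \sum_i x 0 i * y 0 i.

Definition edist x y : R := Num.sqrt (dot (x - y) (x - y)).

(* Reflection in the hyperplane bisecting the segment [x, y]. *)
Definition bisector_reflection x y z : 'rV[R]_N :=
  z - (2 * dot (z - 2^-1 *: (x + y)) (x - y) / dot (x - y) (x - y)) *: (x - y).

(* Adding 0 to the set only serves to give the empty set diameter 0. *)
Definition ediam A : \bar R :=
  ereal_sup (0%E |` [set (edist x y)%:E | x in A & y in A]).

Definition hausdorff_content (s delta : R) A : \bar R :=
  ereal_inf [set (\sum_(0 <= k <oo) (ediam (U k) `^ s))%E |
    U in [set U : (set 'rV[R]_N)^nat |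
      A `<=` \bigcup_k U k /\ forall k, (ediam (U k) <= delta%:E)%E]].

Definition hausdorff_measure (s : R) A : \bar R :=
  ereal_sup [set hausdorff_content s delta A | delta in [set delta | 0 < delta]].

End Euclidean.

Notation borel R N := (g_sigma_algebraType (@open 'rV[R]_N)).

Record ifs (R : realType) (N : nat) := Ifs {
  nmaps : nat;
  scale : R;
  maps : 'I_nmaps -> 'rV[R]_N -> 'rV[R]_N;
  attractor : set 'rV[R]_N }.

Section NestedFractal.
Variables (R : realType) (N : nat) (F : ifs R N).
Local Notation pt := 'rV[R]_N.
Local Notation M := (nmaps F).
Local Notation L := (scale F).
Local Notation phi := (@maps R N F).
Local Notation K := (attractor F).
Implicit Types (w : seq 'I_M) (m : nat) (x y : pt).

Definition Phi (A : set pt) : set pt := \bigcup_i (phi i @` A).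

Definition V0 : set pt :=
  [set x | exists i, phi i x = x /\
     exists j y, [/\ phi j y = y, y <> x & exists k l, phi k x = phi l y]].

Definition Vlev m : set pt := iter m Phi V0.

Definition Vinf : set pt := \bigcup_m Vlev m.

Definition phiw w : pt -> pt := foldr (fun i g => phi i \o g) id w.

Definition cell w : set pt := phiw w @` K.

Definition simplices m : set (set pt) :=
  [set cell w | w in [set w | size w = m]].

Record nested_fractal : Prop := NestedFractal {
  nf_nmaps : (2 <= M)%N;
  nf_scale : 1 < L;
  nf_similitude : forall i x y, edist (phi i x) (phi i y) = L^-1 * edist x y;
  nf_compact : compact K;
  nf_nonempty : K !=set0;
  nf_selfsimilar : K = Phi K;
  nf_diam : ediam K = 1%E;
  nf_essential : exists x y, [/\ V0 x, V0 y & x <> y];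
  nf_open_set : exists U : set pt, [/\ open U, U !=set0, Phi U `<=` U &
    forall i j, i != j -> phi i @` U `&` phi j @` U = set0];
  nf_nesting : forall m w v, (1 <= m)%N -> size w = m -> size v = m ->
    cell w <> cell v ->
    cell w `&` cell v = (phiw w @` V0) `&` (phiw v @` V0);
  nf_connectivity : forall x y, Vlev 1 x -> Vlev 1 y ->
    clos_refl_trans pt
      (fun u v => exists i, (phi i @` V0) u /\ (phi i @` V0) v) x y;
  nf_symmetry : forall x y, V0 x -> V0 y -> x <> y ->
    forall i, exists j,
      bisector_reflection x y @` (phi i @` V0) = phi j @` V0 }.

Definition hdim : R := ln M%:R / ln L.

(* The Borel measures mu and nu live on the ambient space and charge only K. *)
Definition normalized_hausdorff (mu : {measure set (borel R N) -> \bar R}) :=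
  mu K = 1%E /\
  exists2 c : R, 0 < c & forall A : set (borel R N), measurable A ->
    mu A = (c%:E * hausdorff_measure hdim (A `&` K))%E.

(* For x in K \ Vinf this is [w]_m, the m-th truncation of the unique address
   of x; elsewhere it is a choice of one such word, or nil if there is none. *)
Definition word m x : seq 'I_M :=
  oapp val [::] [pick w : m.-tuple 'I_M | `[< cell w x >]].

Definition Delta m x : set pt := cell (word m x).

Definition star m (D : set pt) : set pt :=
  D `|` \bigcup_(T in [set T | simplices m T /\ T `&` D !=set0]) T.

Definition property_P : Prop :=
  exists2 alpha : R, 0 < alpha &
    forall n x y, (1 <= n)%N -> (K `\` Vinf) x -> (K `\` Vinf) y ->
      (star n (Delta n x) `\` star n.+1 (Delta n.+1 x)) y ->
      alpha * L ^- n <= edist x y.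

Definition eball x (r : R) : set pt := [set y | K y /\ edist x y <= r].

End NestedFractal.

(* Conductivities are functions of pairs of points, of which only the values
   on V0 x V0 matter. *)
Record form_data (R : realType) (N : nat) := FormData {
  conductivity : 'rV[R]_N -> 'rV[R]_N -> R;
  renormalization : R }.

Section Form.
Variables (R : realType) (N : nat) (F : ifs R N) (S : form_data R N).
Local Notation pt := 'rV[R]_N.
Local Notation M := (nmaps F).
Local Notation L := (scale F).
Local Notation phi := (@maps R N F).
Local Notation K := (attractor F).
Local Notation V0 := (V0 F).
Local Notation a := (conductivity S).
Local Notation rho := (renormalization S).
Implicit Types (f g h : pt -> R) (w : seq 'I_M) (m : nat).

(* Since the reflections are involutions, this monoid is the group they
   generate. *)
Inductive reflection_group : (pt -> pt) -> Prop :=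
| reflection_group1 : reflection_group id
| reflection_groupM x y s : V0 x -> V0 y -> x <> y -> reflection_group s ->
    reflection_group (bisector_reflection x y \o s).

Record conductivity_matrix : Prop := ConductivityMatrix {
  cm_sym : forall x y, V0 x -> V0 y -> a x y = a y x;
  cm_ge0 : forall x y, V0 x -> V0 y -> x <> y -> 0 <= a x y;
  cm_row0 : forall x, V0 x -> \sum_(y \in V0) a x y = 0 }.

Definition irreducible_conductivity : Prop :=
  forall U : set pt, U `<=` V0 -> U !=set0 -> U <> V0 ->
    exists x y, [/\ U x, (V0 `\` U) y & a x y != 0].

Definition form0 f g : R :=
  2^-1 * \sum_(x \in V0) \sum_(y \in V0) a x y * (f x - f y) * (g x - g y).

Record harmonic_structure : Prop := HarmonicStructure {
  hs_conductivity : conductivity_matrix;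
  hs_irreducible : irreducible_conductivity;
  hs_invariant : forall s x y, reflection_group s -> V0 x -> V0 y ->
    a (s x) (s y) = a x y;
  hs_rho : 1 < rho;
  hs_renormalization : forall f,
    inf [set \sum_i form0 (g \o phi i) (g \o phi i) |
          g in [set g | forall x, V0 x -> g x = f x]]
    = rho^-1 * form0 f f }.

Definition walk_dim : R := ln (M%:R * rho) / ln L.

(* Functions on K are represented by functions on the ambient space, of which
   only the values on K matter. *)
Definition form_lev m f g : R :=
  rho ^+ m * \sum_(w : m.-tuple 'I_M) form0 (f \o phiw w) (g \o phiw w).

Definition dom_form : set (pt -> R) :=
  [set f | {within K, continuous f} /\
           has_ubound (range (fun m => form_lev m f f))].

Definition form f g : R := limn (fun m => form_lev m f g).

Definition minimal_extension f h : Prop :=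
  [/\ dom_form h, forall x, V0 x -> h x = f x &
      forall g, dom_form g -> (forall x, V0 x -> g x = f x) ->
        form h h <= form g g].

(* The minimizer is unique on K. *)
Definition Hext f : pt -> R := xget (cst 0) [set h | minimal_extension f h].

Definition harmonic : set (pt -> R) := [set h | minimal_extension h h].

Definition ipH f g : R :=
  form f g + (\sum_(x \in V0) f x) * (\sum_(x \in V0) g x).

Definition Htilde : set (pt -> R) :=
  [set h | harmonic h /\ forall c : R, ipH h (cst c) = 0].

Definition Ptilde h : pt -> R :=
  fun x => h x - ipH h (cst 1) / ipH (cst 1) (cst 1).

Definition Mtilde (i : 'I_M) h : pt -> R := Ptilde (h \o phi i).

Definition Mtildew w h : pt -> R := foldl (fun g i => Mtilde i g) h w.

Definition nondegenerate_structure : Prop :=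
  forall i, exists inv : (pt -> R) -> pt -> R, forall h, Htilde h ->
    [/\ Htilde (inv h),
        forall x, K x -> Mtilde i (inv h) x = h x &
        forall x, K x -> inv (Mtilde i h) x = h x].

(* A form-orthonormal basis e of Htilde identifies it isometrically with R^n:
   vectors become columns of coordinates, operators become matrices and adjoints
   become transposes. *)
Definition orthonormal_basis n (e : 'I_n -> pt -> R) : Prop :=
  [/\ forall i, Htilde (e i),
      forall i j, form (e i) (e j) = (i == j)%:R &
      forall h, Htilde h ->
        exists c : 'I_n -> R, forall x, K x -> h x = \sum_i c i * e i x].

Section Coordinates.
Variables (n : nat) (e : 'I_n -> pt -> R).

Definition coords h : 'cV[R]_n := \col_i form h (e i).

Definition Mmx w : 'M[R]_n := \matrix_(i, j) form (Mtildew w (e j)) (e i).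

Definition Gram w : 'M[R]_n := (Mmx w)^T *m Mmx w.

Definition kusuoka_measure (nu : {measure set (borel R N) -> \bar R}) : Prop :=
  [/\ nu (~` K) = 0%E, forall x : pt, nu [set x] = 0%E &
      forall w, nu (cell w) = (rho ^+ size w * \tr (Gram w))%:E].

Definition Zlev m (x : pt) : 'M[R]_n :=
  (\tr (Gram (word F m x)))^-1 *: Gram (word F m x).

Definition kusuoka_density (nu : {measure set (borel R N) -> \bar R})
    (Z : pt -> 'M[R]_n) : Prop :=
  (forall i j, measurable_fun (K : set (borel R N)) (fun x => Z x i j)) /\
  {ae nu, forall x : pt, (K `\` Vinf F) x ->
    forall i j, (fun m => Zlev m x i j) @ \oo --> Z x i j}.

Definition grad_lev m f (x : pt) : 'cV[R]_n :=
  invmx (Mmx (word F m x)) *m coords (Ptilde (Hext (f \o phiw (word F m x)))).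

Definition qform (Z : 'M[R]_n) (v : 'cV[R]_n) : R := (v^T *m Z *m v) 0 0.

Definition energy_seminorm (nu : {measure set (borel R N) -> \bar R})
    (Z : pt -> 'M[R]_n) (G : pt -> 'cV[R]_n) : \bar R :=
  ((\int[nu]_(x in K) (qform (Z x) (G x))%:E) `^ 2^-1)%E.

Definition is_gradient (nu : {measure set (borel R N) -> \bar R})
    (Z : pt -> 'M[R]_n) f (G : pt -> 'cV[R]_n) : Prop :=
  (forall i, measurable_fun (K : set (borel R N)) (fun x => G x i 0)) /\
  (fun m => energy_seminorm nu Z (fun x => grad_lev m f x - G x)) @ \oo
    --> 0%E.

End Coordinates.
End Form.

(* Main.v *)
Require Import Defs.
From mathcomp Require Import all_boot all_order all_algebra.
From mathcomp Require Import all_classical all_reals all_analysis.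
From mathcomp Require Import measurable_realfun ring lra.
Import Order.TTheory GRing.Theory Num.Theory.
Import numFieldNormedType.Exports.
Local Open Scope classical_set_scope.
Local Open Scope ring_scope.

(** The inequality is a consequence of a stronger, pointwise one. Since
    1 < rho, functions of finite energy are Hoelder continuous: if x and y lie in
    a cell of level m, then

      |f x - f y| <= C (rho ^- m * (energy of f carried by the cell)) ^ (1/2).

    This is proved by chaining (oscillation). Irreducibility of the
    conductivities and connectivity of the first-level graph bound the increment
    of f between neighbouring vertices by the energy of the cell (poincare_V0,
    poincare_V1), and the increments along a descending chain of cells form a
    geometric series of ratio rho ^- 1/2.

    The energy carried by a cell is then read off the gradient. On harmonic
    functions the form equals its level-0 value, which makes them a space with
    form-orthonormal coordinates in which the Gram matrices satisfy
    Gram w = rho * sum_i Gram (w i) (Gram_rcons). Hence the integrals over a cell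
    of the densities Z_m do not depend on m, and dominated convergence gives the
    integral of Z itself (integral_Z). The level-m gradient is a constant on each
    m-cell, chosen so that its square is the level-0 energy of f there
    (qform_gradient), so its integral over a cell w is rho ^ |w| times the energy
    of f o phi_w at level m - |w| (integral_grad_lev). Letting m tend to infinity
    in the seminorm that defines the gradient bounds the energy on the cell by
    the integral of <grad f, Z grad f> (energy_le_integral).

    All this presupposes that harmonic functions exist. They are constructed:
    the one-step minimization problem is solved by the parallelogram law
    (minimizer), its solutions are iterated along words, and the chaining
    estimate shows that the vertex values converge to a continuous function
    (vertex_data_extends). Well-definedness rests on the nesting axiom, which in
    turn requires that different words of one length have different cells; this
    holds because otherwise K would have Hausdorff measure 0 (cell_inj).

    Finally property (P) compares balls with cells: a point within distance
    alpha * L ^- n of x lies in the star of level n + 1 around x (near_star).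
    So a ball of radius r is covered by cells of size comparable with r, each
    meeting the cell of the centre and contained in a larger concentric ball
    (ball_cells). As rho = L ^ (d_w - d), the pointwise bound on these cells is
    the right-hand side, and a function that stays within t of a constant has
    mean oscillation at most 2 t (mean_oscillation). *)

Set Implicit Arguments.
Unset Strict Implicit.
Local Notation dist := Defs.edist.

(** * Euclidean distance and topology *)

Section Euclid.
Variables (R : realType) (N : nat).
Implicit Types (x y z : 'rV[R]_N) (A : set 'rV[R]_N) (f : 'rV[R]_N -> R).

Lemma dot_ge0 x : 0 <= dot x x.
Proof. by apply: sumr_ge0 => i _; rewrite -expr2 sqr_ge0. Qed.

Lemma dist_ge0 x y : 0 <= dist x y.
Proof. exact: sqrtr_ge0. Qed.

Lemma dist_sqr x y : dist x y ^+ 2 = dot (x - y) (x - y).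
Proof. by rewrite sqr_sqrtr // dot_ge0. Qed.

Lemma distxx x : dist x x = 0.
Proof.
by rewrite /Defs.edist subrr /dot big1 ?sqrtr0 // => i _; rewrite mxE mul0r.
Qed.

(** The constant 2 comes from the squares alone, coordinate by coordinate; all
    the geometric constants below may absorb it. *)
Lemma dist_quasi_triangle x y z :
  dist x z ^+ 2 <= 2 * (dist x y ^+ 2 + dist y z ^+ 2).
Proof.
rewrite !dist_sqr /dot -big_split mulr_sumr /=; apply: ler_sum => i _.
rewrite !mxE; set a := x 0 i; set b := y 0 i; set c := z 0 i.
have := sqr_ge0 ((a - b) - (b - c)); nra.
Qed.

Lemma norm_le_dist x y : `|x - y| <= dist x y.
Proof.
rewrite /Num.norm /= mx_normrE; apply/bigmax_leP; split; first exact: dist_ge0.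
move=> [i j] _ /=; rewrite (ord1 i).
rewrite -(ler_pXn2r (ltn0Sn 1)) ?nnegrE ?dist_ge0 //.
rewrite dist_sqr /dot (bigD1 j) //= real_normK ?num_real // expr2 lerDl.
by apply: sumr_ge0 => k _; rewrite -expr2 sqr_ge0.
Qed.

Lemma coord_le_norm x i : `|x 0 i| <= `|x|.
Proof.
rewrite [leRHS]/Num.norm /= mx_normrE.
exact: (le_bigmax _ (fun ij : 'I_1 * 'I_N => `|x ij.1 ij.2|) (0, i)).
Qed.

Lemma dist_le_norm x y : dist x y <= N.+1%:R * `|x - y|.
Proof.
rewrite -(ler_pXn2r (ltn0Sn 1)) ?nnegrE ?dist_ge0 ?mulr_ge0 //.
rewrite dist_sqr /dot exprMn.
apply: (@le_trans _ _ (\sum_(i < N) `|x - y| ^+ 2)).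
  apply: ler_sum => i _; rewrite -expr2 -real_normK ?num_real //.
  by rewrite ler_pXn2r ?nnegrE // coord_le_norm.
rewrite sumr_const card_ord -[leLHS]mulr_natl ler_wpM2r ?sqr_ge0 //.
by rewrite -natrX ler_nat (leq_trans (leqnSn N)) // -[leqLHS]muln1 leq_mul.
Qed.

Lemma dist_ballP x (U : set 'rV[R]_N) :
  nbhs x U <-> exists2 e : R, 0 < e & forall y, dist x y < e -> U y.
Proof.
split=> [/nbhs_ballP[e /= e0 sU]|[e e0 sU]].
  exists e => // y xy; apply: sU; rewrite -ball_normE /=.
  exact: le_lt_trans (norm_le_dist x y) xy.
apply/nbhs_ballP; exists (e / N.+1%:R) => /=; first by rewrite divr_gt0.
move=> y; rewrite -ball_normE /= ltr_pdivlMr // => xy; apply: sU.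
by apply: le_lt_trans (dist_le_norm x y) _; rewrite mulrC.
Qed.

Lemma closed_distP A :
  closed A <-> forall x, (forall e, 0 < e -> exists2 y, A y & dist x y < e) -> A x.
Proof.
split=> [clA x xA|clA x xA].
  apply: clA => U /dist_ballP[e e0 sU].
  by have [y Ay xy] := xA e e0; exists y; split=> //; apply: sU.
apply: clA => e e0.
have [|y [Ay xy]] := xA [set y | dist x y < e]; last by exists y.
by apply/dist_ballP; exists e.
Qed.

(** Continuity on K is used and produced below only in this form, where the
    points of comparison stay in K. *)
Lemma within_continuous_distP A f :
  {within A, continuous f} <->
  forall x, A x -> forall e, 0 < e ->
    exists2 d, 0 < d & forall y, A y -> dist x y < d -> `|f x - f y| < e.
Proof.
rewrite subspace_continuousP; split=> cf x Ax.
  move=> e e0; have /cvgrPdist_lt/(_ e e0) := cf x Ax.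
  rewrite near_withinE => /dist_ballP[d d0 sd]; exists d => // y Ay xy.
  exact: sd.
apply/cvgrPdist_lt => e e0; rewrite near_withinE.
have [d d0 sd] := cf x Ax e e0; apply/dist_ballP; exists d => // y xy Ay.
exact: sd.
Qed.

Lemma within_continuous_eq A f g : (forall x, A x -> f x = g x) ->
  {within A, continuous f} -> {within A, continuous g}.
Proof.
move=> fg /within_continuous_distP cf; apply/within_continuous_distP=> x Ax e e0.
have [d d0 sd] := cf x Ax e e0; exists d => // y Ay xy.
by rewrite -!fg //; apply: sd.
Qed.

Lemma measurable_closed A : closed A -> measurable (A : set (borel R N)).
Proof.
move=> clA; rewrite -[A]setCK; apply: measurableC; apply: sub_sigma_algebra.
by rewrite openC.
Qed.

Lemma measurable_within_continuous A f : closed A ->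
  {within A, continuous f} -> measurable_fun (A : set (borel R N)) f.
Proof.
move=> clA /within_continuous_distP cf.
apply: (measurability (@measurable_realfun.RGenCInfty.G R)) => [|_ [_ [a ->] <-]].
  exact: measurable_realfun.RGenCInfty.measurableE.
apply: measurable_closed.
apply/closed_distP => x xA.
have Ax : A x.
  have /closed_distP := clA; apply=> e e0.
  by have [y [Ay _] xy] := xA e e0; exists y.
split=> //; rewrite /= in_itv /= andbT leNgt; apply/negP => fxa.
have [|d d0 sd] := cf x Ax (a - f x); first by rewrite subr_gt0.
have [y [Ay /=]] := xA d d0; rewrite in_itv /= andbT => afy xy.
have := sd y Ay xy; rewrite distrC ltr_norml => /andP[_ h]; lra.
Qed.

Lemma uniform_bound (T : choiceType) (A : set T) (P : T -> R -> Prop) :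
  finite_set A -> (forall t b c, b <= c -> P t b -> P t c) ->
  (forall t, A t -> exists c, P t c) ->
  exists c, forall t, A t -> P t c.
Proof.
move=> finA mono.
have : forall s : seq T, (forall t, t \in s -> exists c, P t c) ->
    exists c, forall t, t \in s -> P t c.
  elim=> [|t s IH] H; first by exists 0.
  have [|c Hc] := IH; first by move=> u us; apply: H; rewrite inE us orbT.
  have [b Hb] := H t (mem_head _ _).
  exists (Num.max b c) => u; rewrite inE => /predU1P[->|us].
    by apply: mono Hb; rewrite le_max lexx.
  by apply: mono (Hc _ us); rewrite le_max lexx orbT.
move: finA => /finite_seqP[s ->] H HA.
have [c Hc] := H s HA.
by exists c.
Qed.

End Euclid.

(** * Words, cells and vertices *)

Section SelfSimilar.
Variables (R : realType) (N : nat) (F : ifs R N).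
Hypothesis nf : nested_fractal F.
Local Notation pt := 'rV[R]_N.
Local Notation M := (nmaps F).
Local Notation L := (scale F).
Local Notation phi := (@maps R N F).
Local Notation K := (attractor F).
Implicit Types (x y z : pt) (w u v : seq 'I_M) (m : nat).

Lemma small_expr (q e : R) : 0 <= q < 1 -> 0 < e -> exists m, q ^+ m < e.
Proof.
move=> /andP[q0 q1] e0.
have /cvg_expr/cvgrPdist_lt/(_ e e0)[m _ /(_ m (leqnn m))] : `|q| < 1.
  by rewrite ger0_norm.
by rewrite /= sub0r normrN ger0_norm ?exprn_ge0 // => qm; exists m.
Qed.

Lemma scale_gt0 : 0 < L.
Proof. exact: lt_trans (nf_scale nf). Qed.

Lemma scaleX_gt0 m : 0 < L ^- m.
Proof. by rewrite invr_gt0 exprn_gt0 // scale_gt0. Qed.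

Lemma small_scaleX e : 0 < e -> exists m, L ^- m < e.
Proof.
move=> e0; have [||m Hm] := @small_expr L^-1 e => //.
  by rewrite invr_ge0 ltW ?scale_gt0 // invf_lt1 ?scale_gt0 ?nf_scale.
by exists m; rewrite -exprVn.
Qed.

Lemma dist_eq0 x y : dist x y = 0 -> x = y.
Proof.
move=> xy; apply/eqP; rewrite -subr_eq0 -normr_le0 -xy.
exact: norm_le_dist.
Qed.

Lemma maps_inj i : injective (phi i).
Proof.
move=> x y xy; apply: dist_eq0; apply/eqP.
have /eqP := nf_similitude nf i x y.
rewrite xy distxx eq_sym mulf_eq0 invr_eq0 => /predU1P[L0|//].
by have := scale_gt0; rewrite L0 ltxx.
Qed.

Lemma phiw_cat u v x : phiw (u ++ v) x = phiw u (phiw v x).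
Proof. by elim: u => //= i u IH; rewrite IH. Qed.

Lemma phiw_rcons u i x : phiw (rcons u i) x = phiw u (phi i x).
Proof. by rewrite -cats1 phiw_cat. Qed.

Lemma phiw_rconsE u i : phiw (rcons u i) = phiw u \o phi i.
Proof. by apply/funext => x; rewrite phiw_rcons. Qed.

Lemma phiw_inj w : injective (phiw w).
Proof. by elim: w => [|i w IH] x y //= /maps_inj/IH. Qed.

Lemma dist_phiw w x y : dist (phiw w x) (phiw w y) = L ^- size w * dist x y.
Proof.
elim: w => [|i w IH] /=; first by rewrite expr0 invr1 mul1r.
by rewrite nf_similitude // IH mulrA exprS invfM.
Qed.

Lemma attractor_closed : closed K.
Proof. exact: compact_closed (@norm_hausdorff _ _) (nf_compact nf). Qed.

Lemma maps_attractor i x : K x -> K (phi i x).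
Proof. by move=> Kx; rewrite (nf_selfsimilar nf); exists i => //; exists x. Qed.

Lemma phiw_attractor w x : K x -> K (phiw w x).
Proof. by elim: w => [|i w IH] //= /IH; apply: maps_attractor. Qed.

Lemma attractor_maps x : K x -> exists i y, K y /\ x = phi i y.
Proof.
by rewrite {1}(nf_selfsimilar nf) => -[i _ [y Ky <-]]; exists i, y.
Qed.

Lemma cell_sub w : cell w `<=` K.
Proof. by move=> _ [x Kx <-]; apply: phiw_attractor. Qed.

Lemma cell_nil : cell ([::] : seq 'I_M) = K.
Proof. by apply/seteqP; split=> [_ [x Kx <-]|x Kx] //; exists x. Qed.

Lemma cell_cat u v : cell (u ++ v) `<=` cell u.
Proof.
move=> _ [x Kx <-]; exists (phiw v x); first exact: phiw_attractor.
by rewrite phiw_cat.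
Qed.

Lemma cell_rconsP w x : cell w x <-> exists i, cell (rcons w i) x.
Proof.
split=> [[y /attractor_maps[i [z [Kz ->]]] <-]|[i]].
  by exists i, z => //; rewrite phiw_rcons.
by rewrite -cats1; apply: cell_cat.
Qed.

Lemma cell_word m x : K x -> exists2 w : seq 'I_M, size w = m & cell w x.
Proof.
elim: m x => [|m IH] x Kx; first by exists [::] => //; rewrite cell_nil.
have [w sw /cell_rconsP[i xi]] := IH x Kx.
by exists (rcons w i) => //; rewrite size_rcons sw.
Qed.

Lemma attractor_dist_le1 x y : K x -> K y -> dist x y <= 1.
Proof.
move=> Kx Ky; rewrite -lee_fin -(nf_diam nf); apply: ereal_sup_ubound.
by right; exists x => //; exists y.
Qed.

Lemma cell_dist_le w x y : cell w x -> cell w y -> dist x y <= L ^- size w.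
Proof.
move=> [a Ka <-] [b Kb <-]; rewrite dist_phiw.
by rewrite ler_piMr ?(ltW (scaleX_gt0 _)) // attractor_dist_le1.
Qed.

Lemma fixed_unique i x y : phi i x = x -> phi i y = y -> x = y.
Proof.
move=> xi yi; apply: dist_eq0; apply/eqP.
have /eqP := nf_similitude nf i x y.
rewrite xi yi -[X in X == _]mul1r -subr_eq0 -mulrBl mulf_eq0 => /predU1P[|->//].
move/eqP; rewrite subr_eq0 eq_sym invr_eq1 => /eqP L1.
by have := nf_scale nf; rewrite L1 ltxx.
Qed.

Lemma phiw_nseq_fixed i x m : phi i x = x -> phiw (nseq m i) x = x.
Proof. by move=> ix; elim: m => //= m ->. Qed.

Lemma fixed_attractor i x : phi i x = x -> K x.
Proof.
move=> ix; have [y Ky] := nf_nonempty nf.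
have /closed_distP := attractor_closed; apply=> e e0.
have d0 : 0 < 1 + dist x y by rewrite ltr_pwDl ?dist_ge0.
have [m Hm] : exists m, L ^- m < e / (1 + dist x y).
  by apply: small_scaleX; rewrite divr_gt0.
exists (phiw (nseq m i) y); first exact: phiw_attractor.
rewrite -{1}(phiw_nseq_fixed m ix) dist_phiw size_nseq.
rewrite ltr_pdivlMr // in Hm; apply: le_lt_trans Hm.
by rewrite ler_wpM2l ?(ltW (scaleX_gt0 _)) // lerDr.
Qed.

Lemma V0_attractor : V0 F `<=` K.
Proof. by move=> x [i [/fixed_attractor]]. Qed.

Lemma V0_nonempty : V0 F !=set0.
Proof. by have [x [y [Vx _ _]]] := nf_essential nf; exists x. Qed.

Lemma V0_finite : finite_set (V0 F).
Proof.
pose c (i : 'I_M) : pt := xget 0 [set x | phi i x = x].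
apply: (@sub_finite_set _ _ (c @` [set: 'I_M])); last exact: finite_image.
move=> x [i [ix _]]; exists i => //; rewrite /c; case: xgetP => [y _ /= iy|].
  exact: fixed_unique iy ix.
by move=> /(_ x).
Qed.

Lemma Phi_finite A : finite_set A -> finite_set (Phi F A).
Proof. by move=> fA; apply: bigcup_finite => // i _; apply: finite_image. Qed.

Lemma Vlev1_finite : finite_set (Vlev F 1).
Proof. exact: Phi_finite V0_finite. Qed.

Lemma V0_Vlev1 : V0 F `<=` Vlev F 1.
Proof. by move=> x Vx; have [i [ix _]] := Vx; exists i => //; exists x. Qed.

Lemma VlevP m x : Vlev F m x <-> exists2 w : seq 'I_M, size w = m & (phiw w @` V0 F) x.
Proof.
elim: m x => [|m IH] x; split.
- by move=> Vx; exists [::] => //; exists x.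
- by move=> [w /size0nil -> [y Vy <-]].
- move=> [i _ [y /IH[w sw [z Vz <-]] <-]].
  by exists (i :: w); rewrite /= ?sw //; exists z.
- move=> [[//|i w] [sw] [z Vz <-]]; exists i => //; exists (phiw w z) => //.
  by apply/IH; exists w => //; exists z.
Qed.

Lemma Vinf_countable : countable (Vinf F).
Proof.
apply: bigcup_countable => // m _; apply: finite_set_countable.
by elim: m => [|m IH]; [exact: V0_finite|exact: Phi_finite].
Qed.

End SelfSimilar.

(** * Distinct words have distinct cells *)

Section Hausdorff.
Variables (R : realType) (N : nat).
Implicit Types (x y : 'rV[R]_N) (A U : set 'rV[R]_N).

Lemma In_nthP (T : Type) (a b : T) (s : seq T) :
  List.In b s <-> exists2 k, (k < size s)%N & nth a s k = b.
Proof.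
elim: s => [|c s IH] /=; first by split=> // -[].
split=> [[->|/IH[k ks kb]]|[[|k] ks kb]]; first by exists 0%N.
- by exists k.+1.
- by left.
- by right; apply/IH; exists k.
Qed.

Lemma ediam_ge0 U : (0 <= ediam U)%E.
Proof. by apply: ereal_sup_ubound; left. Qed.

Lemma ediam_le U (t : R) : 0 <= t -> (forall x y, U x -> U y -> dist x y <= t) ->
  (ediam U <= t%:E)%E.
Proof.
move=> t0 Ut; apply: ub_ereal_sup => _ [->|[x Ux [y Uy <-]]]; rewrite lee_fin //.
exact: Ut.
Qed.

Lemma ediam_set0 : ediam (set0 : set 'rV[R]_N) = 0%E.
Proof. by apply/eqP; rewrite eq_le ediam_ge0 andbT ediam_le. Qed.

(** Finite covers are enough: they become sequences when padded with empty
    sets, whose diameter is 0 and which count for 0 because s is positive. *)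
Lemma hausdorff_measure_eq0 (s : R) A : 0 < s ->
  (forall e, 0 < e -> exists (S : seq (set 'rV[R]_N)) (t : R),
    [/\ 0 <= t < e, (size S)%:R * t `^ s < e,
        forall x, A x -> exists2 U, List.In U S & U x &
        forall U, List.In U S -> forall x y, U x -> U y -> dist x y <= t]) ->
  hausdorff_measure s A = 0%E.
Proof.
move=> s0 H; apply/eqP; rewrite eq_le; apply/andP; split; last first.
  apply: le_trans (_ : hausdorff_content s 1 A <= _)%E.
    apply: le_ereal_inf_tmp => _ [U _ <-].
    by apply: nneseries_ge0 => k _ _; exact: poweR_ge0.
  by apply: ereal_sup_ubound; exists 1 => //=; exact: ltr01.
apply: ub_ereal_sup => _ [d /= d0 <-]; apply/lee_addgt0Pr => e e0; rewrite add0e.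
have [|S [t [/andP[t0 td] St SA Sd]]] := H (Num.min d e).
  by rewrite lt_min d0.
rewrite lt_min in St; have {St} Se : (size S)%:R * t `^ s <= e.
  by rewrite ltW //; case/andP: St.
rewrite lt_min in td; case/andP: td => td _.
pose U k := nth set0 S k.
have Uk k : (k < size S)%N -> (ediam (U k) <= t%:E)%E.
  move=> kS; apply: ediam_le => // x y; apply: Sd.
  by apply/(In_nthP set0); exists k.
apply: (@le_trans _ _ (\sum_(0 <= k <oo) (ediam (U k) `^ s))%E).
  apply: ereal_inf_lbound; exists U => //; split.
    move=> x /SA[B /(In_nthP set0)[k kS kB] Bx].
    by exists k => //; rewrite /U kB.
  move=> k; have [kS|Sk] := ltnP k (size S).
    by rewrite (le_trans (Uk _ kS)) // lee_fin ltW.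
  by rewrite /U nth_default // ediam_set0 lee_fin ltW.
rewrite (nneseries_split 0 (size S)); last by move=> k _; exact: poweR_ge0.
rewrite add0n [X in (_ + X)%E]eseries0 ?adde0; last first.
  by move=> k Sk _; rewrite /U nth_default // ediam_set0 poweR0r // gt_eqF.
apply: (@le_trans _ _ (\sum_(0 <= k < size S) (t `^ s)%:E)%E).
  rewrite !big_mkord; apply: lee_sum => k _; rewrite -poweR_EFin.
  apply: gt0_ler_poweR; [exact: ltW| | |exact: Uk].
    by rewrite in_itv /= ediam_ge0 leey.
  by rewrite in_itv /= lee_fin t0 leey.
by rewrite sumEFin lee_fin big_mkord sumr_const card_ord -[leLHS]mulr_natl.
Qed.

Lemma measurable_countable A : countable A -> measurable (A : set (borel R N)).
Proof.
apply: (@countable_measurable _ (borel R N)) => x; apply: measurable_closed.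
exact: accessible_closed_set1 (hausdorff_accessible (@norm_hausdorff _ _)) _.
Qed.

Lemma countable_null (mu : {measure set (borel R N) -> \bar R}) A :
  (forall x : 'rV[R]_N, mu [set x] = 0%E) -> countable A -> mu A = 0%E.
Proof.
move=> mu1 cA; have /countable_injP[f fi] := cA.
suff : mu.-negligible A.
  by move=> /negligibleP; apply; exact: measurable_countable.
have -> : A = \bigcup_k [set x | A x /\ f x = k].
  by apply/seteqP; split=> [x Ax|x [k _ []]] //; exists (f x).
apply: negligible_bigcup => k.
have [[x [Ax fx]]|H] := pselect (exists x, A x /\ f x = k); last first.
  exists set0; split=> // x Hx; exfalso; apply: H; by exists x.
exists [set x]; split=> //; first exact: measurable_countable.
by move=> y [Ay fy]; apply: fi; rewrite ?inE // fx fy.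
Qed.

End Hausdorff.

Section DistinctCells.
Variables (R : realType) (N : nat) (F : ifs R N).
Hypothesis nf : nested_fractal F.
Local Notation pt := 'rV[R]_N.
Local Notation M := (nmaps F).
Local Notation L := (scale F).
Local Notation K := (attractor F).
Local Notation d := (hdim F).
Implicit Types (x y z : pt) (w u v : seq 'I_M) (m : nat).

Lemma nmaps_gt1 : 1 < M%:R :> R.
Proof. by rewrite ltr1n; exact: nf_nmaps nf. Qed.

Lemma lnscale_gt0 : 0 < ln L.
Proof. by rewrite ln_gt0 // nf_scale. Qed.

Lemma hdim_gt0 : 0 < d.
Proof. by rewrite divr_gt0 ?lnscale_gt0 // ln_gt0 // nmaps_gt1. Qed.

Lemma scale_powR : L `^ d = M%:R.
Proof.
apply: ln_inj; rewrite ?posrE ?powR_gt0 ?(scale_gt0 nf) //.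
  by rewrite (lt_trans _ nmaps_gt1).
by rewrite ln_powR divfK // gt_eqF // lnscale_gt0.
Qed.

Lemma scaleX_powR m : (L ^- m) `^ d = M%:R ^- m.
Proof.
have L0 := ltW (scale_gt0 nf).
rewrite -[L ^+ m]powR_mulrn // -powRN -powRrM mulrC powRrM scale_powR powRN.
by rewrite powR_mulrn.
Qed.

Variable mu : {measure set (borel R N) -> \bar R}.
Hypothesis hmu : normalized_hausdorff F mu.

Lemma hausdorff_measure_attractor : hausdorff_measure d K <> 0%E.
Proof.
move=> HK; have [muK [c c0 mucE]] := hmu.
have mK : measurable (K : set (borel R N)).
  exact: measurable_closed (attractor_closed nf).
have := mucE K mK; rewrite setIid HK mule0 muK => -[] /eqP.
by rewrite oner_eq0.
Qed.

Lemma mu_set1 x : mu [set x] = 0%E.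
Proof.
have [muK [c c0 ->]] := hmu; last exact: measurable_countable (countable1 _).
rewrite (@hausdorff_measure_eq0 R N d) ?mule0 ?hdim_gt0 //.
move=> e e0; exists [:: [set x]], 0.
rewrite e0 lexx powR0 ?mulr0 ?gt_eqF ?hdim_gt0 //; split=> //.
  by move=> y [-> _]; exists [set x] => //; left.
by move=> _ [<-|//] y z -> ->; rewrite distxx.
Qed.

(** If two distinct words of length m had the same cell, K would be covered by
    (M ^ m - 1) ^ k cells of diameter L ^ (- m k) for every k, and its
    d-dimensional Hausdorff measure would vanish. *)
Lemma cell_inj w v : size w = size v -> cell w = cell v -> w = v.
Proof.
move=> swv cwv; apply: contrapT => nwv; apply: hausdorff_measure_attractor.
set m := size w in swv *.
have m0 : (0 < m)%N.
  rewrite lt0n; apply/eqP => m0; apply: nwv.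
  by rewrite (size0nil m0) [v]size0nil // -swv.
pose S1 : seq (seq 'I_M) := [seq val t | t <- enum {:m.-tuple 'I_M} & val t != v].
have cov1 x : K x -> exists2 u, u \in S1 & cell u x.
  move=> Kx.
  have inS1 u : size u = m -> u != v -> u \in S1.
    move=> su uv; apply/mapP; exists (Tuple (introT eqP su)) => //.
    by rewrite mem_filter /= uv mem_enum.
  have [u su xu] := cell_word nf m Kx; have [uv|uv] := eqVneq u v.
    by exists w; [apply: inS1 => //; apply/eqP|rewrite cwv -uv].
  by exists u => //; apply: inS1.
have size1 u : u \in S1 -> size u = m.
  by move=> /mapP[t _ ->]; rewrite size_tuple.
have sizeS1 : (size S1 = (M ^ m).-1)%N.
  pose tv : m.-tuple 'I_M := Tuple (introT eqP (esym swv)).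
  rewrite -[M in RHS]card_ord -card_tuple -(cardC1 tv) size_map size_filter.
  rewrite cardE /enum_mem size_filter count_filter; apply: eq_count => t.
  by rewrite !inE andbT -(inj_eq val_inj).
pose Sk := fix Sk k : seq (seq 'I_M) :=
  if k is k'.+1 then [seq u ++ t | u <- S1, t <- Sk k'] else [:: [::]].
have covk k x : K x -> exists2 u, u \in Sk k & cell u x.
  elim: k x => [|k IH] x Kx; first by exists [::]; rewrite ?inE // cell_nil.
  have [u uS [y /IH[t tS [z Kz <-]] <-]] := cov1 x Kx.
  exists (u ++ t); first exact: allpairs_f.
  by exists z => //; rewrite phiw_cat.
have sizek k u : u \in Sk k -> size u = (m * k)%N.
  elim: k u => [|k IH] u; first by rewrite inE => /eqP->; rewrite muln0.
  move=> /allpairsP[[a b] /= [/size1 sa /IH sb ->]].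
  by rewrite size_cat sa sb mulnS.
have sizeSk k : (size (Sk k) = size S1 ^ k)%N.
  by elim: k => //= k IH; rewrite size_allpairs IH expnS.
pose q : R := (M ^ m).-1%:R / (M ^ m)%:R.
have Mm0 : (0 < M ^ m)%N by rewrite expn_gt0 (ltn_trans _ (nf_nmaps nf)).
have q01 : 0 <= q < 1.
  by rewrite divr_ge0 //= ltr_pdivrMr ?ltr0n // mul1r ltr_nat prednK.
have L01 : 0 <= L ^- m < 1.
  rewrite ltW ?(scaleX_gt0 nf) //= invf_lt1 ?exprn_gt0 ?(scale_gt0 nf) //.
  by rewrite exprn_egt1 ?nf_scale // -lt0n.
apply: hausdorff_measure_eq0 => [|e e0]; first exact: hdim_gt0.
pose b := Num.max q (L ^- m).
have b01 : 0 <= b < 1.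
  by rewrite le_max gt_max; case/andP: q01 => -> ->; case/andP: L01 => _ ->.
have [k bk] := small_expr b01 e0.
have {}bk p : 0 <= p -> p <= b -> p ^+ k < e.
  by move=> p0 pb; apply: le_lt_trans bk; rewrite lerXn2r ?nnegrE // (le_trans p0).
exists (map (@cell R N F) (Sk k)), (L ^- (m * k)); split.
- rewrite ltW ?(scaleX_gt0 nf) //= exprM -exprVn bk ?le_max ?lexx ?orbT //.
  by case/andP: L01.
- rewrite size_map sizeSk sizeS1 scaleX_powR.
  have -> : M%:R ^- (m * k) = ((M ^ m)%:R^-1) ^+ k :> R.
    by rewrite exprVn natrX exprM.
  rewrite natrX -exprMn.
  by rewrite bk ?le_max ?lexx //; case/andP: q01.
- move=> x /(covk k)[u uS xu]; exists (cell u) => //.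
  by elim: (Sk k) uS => //= a s IH; rewrite inE => /predU1P[->|/IH]; [left|right].
- move=> U; have : all (fun u => size u == (m * k)%N) (Sk k).
    by apply/allP => u /sizek->.
  elim: (Sk k) => //= a s IH /andP[/eqP sa /IH{}IH] [<- x y|/IH//].
  by rewrite -sa; apply: cell_dist_le.
Qed.

End DistinctCells.

(** * Energies and discrete Poincare inequalities *)

Section Energy.
Variables (R : realType) (N : nat) (F : ifs R N) (S : form_data R N).
Hypotheses (nf : nested_fractal F) (hs : harmonic_structure F S).
Local Notation pt := 'rV[R]_N.
Local Notation M := (nmaps F).
Local Notation phi := (@maps R N F).
Local Notation K := (attractor F).
Local Notation a := (conductivity S).
Local Notation rho := (renormalization S).
Local Notation form0 := (form0 F S).
Implicit Types (x y z : pt) (w u v : seq 'I_M) (m : nat) (f g h : pt -> R).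

Lemma rho_gt0 : 0 < rho.
Proof. exact: lt_trans (hs_rho hs). Qed.

(** All linear combinations below are built with this one operation, which
    commutes definitionally with composition. *)
Definition axpy (c : R) f g : pt -> R := fun x => c * f x + g x.

Let vs : seq pt := finmap.enum_fset (fset_set (V0 F)).

Lemma mem_vs x : (x \in vs) = `[< V0 F x >].
Proof.
apply/idP/asboolP; first by rewrite in_fset_set ?inE //; exact: V0_finite.
by move=> Vx; rewrite in_fset_set ?inE //; exact: V0_finite.
Qed.

Lemma form0E f g : form0 f g =
  2^-1 * \sum_(x <- vs) \sum_(y <- vs) a x y * (f x - f y) * (g x - g y).
Proof.
rewrite /Defs.form0 fsbig_finite /=; last exact: V0_finite.
by congr (_ * _); apply: eq_bigr => x _; rewrite fsbig_finite //; exact: V0_finite.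
Qed.

Lemma form0_sym f g : form0 f g = form0 g f.
Proof.
rewrite !form0E; congr (_ * _); apply: eq_bigr => x _; apply: eq_bigr => y _.
by rewrite mulrAC.
Qed.

Lemma form0_lin c f g h : form0 (axpy c f g) h = c * form0 f h + form0 g h.
Proof.
rewrite !form0E mulrCA -mulrDr; congr (_ * _); rewrite mulr_sumr -big_split /=.
apply: eq_bigr => x _; rewrite mulr_sumr -big_split; apply: eq_bigr => y _ /=.
by rewrite /axpy; ring.
Qed.

(** Additive constants are allowed for because the operators Mtilde agree with
    composition with the maps phi only up to constants. *)
Lemma form0_ext f g h c : (forall x, V0 F x -> f x = g x + c) ->
  form0 f h = form0 g h.
Proof.
move=> fg; rewrite !form0E; congr (_ * _).
rewrite big_seq [RHS]big_seq; apply: eq_bigr => x; rewrite mem_vs => /asboolP Vx.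
rewrite big_seq [RHS]big_seq; apply: eq_bigr => y; rewrite mem_vs => /asboolP Vy.
by rewrite !fg //; ring.
Qed.

Let term_ge0 f x y : V0 F x -> V0 F y -> 0 <= a x y * (f x - f y) * (f x - f y).
Proof.
move=> Vx Vy; have [->|/eqP xy] := eqVneq x y; first by rewrite subrr !mulr0.
by rewrite -mulrA mulr_ge0 ?(cm_ge0 (hs_conductivity hs)) // -expr2 sqr_ge0.
Qed.

Lemma form0_ge0 f : 0 <= form0 f f.
Proof.
rewrite form0E mulr_ge0 ?invr_ge0 //.
rewrite big_seq; apply: sumr_ge0 => x; rewrite mem_vs => /asboolP Vx.
rewrite big_seq; apply: sumr_ge0 => y; rewrite mem_vs => /asboolP Vy.
exact: term_ge0.
Qed.

Lemma form0_term f x y : V0 F x -> V0 F y ->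
  a x y * (f x - f y) ^+ 2 <= 2 * form0 f f.
Proof.
move=> Vx Vy; rewrite form0E mulVKf ?pnatr_eq0 //.
have xs : x \in vs by rewrite mem_vs; apply/asboolP.
have ys : y \in vs by rewrite mem_vs; apply/asboolP.
rewrite (big_rem x) //= (big_rem y) //= -addrA expr2 mulrA lerDl addr_ge0 //.
  rewrite big_seq; apply: sumr_ge0 => z /mem_rem; rewrite mem_vs => /asboolP Vz.
  exact: term_ge0.
rewrite big_seq; apply: sumr_ge0 => t /mem_rem; rewrite mem_vs => /asboolP Vt.
rewrite big_seq; apply: sumr_ge0 => z; rewrite mem_vs => /asboolP Vz.
exact: term_ge0.
Qed.

Let sqr_split (p q r : R) : (p - r) ^+ 2 <= 2 * ((p - q) ^+ 2 + (q - r) ^+ 2).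
Proof. by have := sqr_ge0 ((p - q) - (q - r)); nra. Qed.

(** Irreducibility makes the set of points that can be compared with a given
    point exhaust V0. *)
Lemma poincare_V0 : exists2 c, 0 < c & forall f x y, V0 F x -> V0 F y ->
  (f x - f y) ^+ 2 <= c * form0 f f.
Proof.
pose P (p : pt * pt) c := 0 <= c /\ forall f, (f p.1 - f p.2) ^+ 2 <= c * form0 f f.
have each p : (V0 F `*` V0 F) p -> exists c, P p c.
  move: p => [x y] [/= Vx Vy].
  pose U := [set z | V0 F z /\ exists c, P (x, z) c].
  suff UV : U = V0 F by have : U y by [rewrite UV]; case.
  apply: contrapT => UV.
  have [||z [t [[Vz [c [c0 Hc]] [Vt Ut] azt]]]] := hs_irreducible hs _ _ UV.
  - by move=> z [].
  - exists x; split=> //; exists 0; split=> // f.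
    by rewrite /= subrr expr0n /= mul0r.
  have zt : z <> t by move=> zt; apply: Ut; rewrite -zt; split=> //; exists c.
  have azt0 : 0 < a z t.
    by rewrite lt_neqAle eq_sym azt (cm_ge0 (hs_conductivity hs)).
  apply: Ut; split=> //; exists (2 * (c + 2 / a z t)); split.
    by rewrite mulr_ge0 // addr_ge0 // divr_ge0 // ltW.
  move=> f /=; apply: le_trans (sqr_split _ (f z) _) _.
  rewrite -mulrA ler_wpM2l // mulrDl; apply: lerD; first exact: Hc.
  by rewrite mulrAC ler_pdivlMr // mulrC form0_term.
have [||c Hc] := uniform_bound _ _ each.
- by apply: finite_setX; exact: V0_finite.
- move=> p b c bc [b0 Hb]; split; first exact: le_trans bc.
  by move=> f; apply: le_trans (Hb f) _; rewrite ler_wpM2r // form0_ge0.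
exists (`|c| + 1) => [|f x y Vx Vy]; first by rewrite ltr_wpDl.
have [_ /(_ f) /= H] := Hc (x, y) (conj Vx Vy); apply: le_trans H _.
by rewrite ler_wpM2r ?form0_ge0 // (le_trans (ler_norm c)) // lerDl.
Qed.

Definition step_energy f : R := \sum_i form0 (f \o phi i) (f \o phi i).
Local Notation energy1 := step_energy.

Lemma energy1_ge0 f : 0 <= energy1 f.
Proof. by apply: sumr_ge0 => i _; exact: form0_ge0. Qed.

Lemma form0_le_energy1 f i : form0 (f \o phi i) (f \o phi i) <= energy1 f.
Proof.
rewrite /step_energy (bigD1 i) //= lerDl sumr_ge0 // => j _; exact: form0_ge0.
Qed.

Lemma poincare_V1 : exists2 c, 0 < c & forall f x y, Vlev F 1 x -> Vlev F 1 y ->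
  (f x - f y) ^+ 2 <= c * energy1 f.
Proof.
have [c0 c00 Hc0] := poincare_V0.
pose P (p : pt * pt) c := forall f, (f p.1 - f p.2) ^+ 2 <= c * energy1 f.
have each p : (Vlev F 1 `*` Vlev F 1) p -> exists c, P p c.
  move: p => [x y] [/= Vx Vy].
  have xy := nf_connectivity nf Vx Vy; clear Vx Vy.
  elim: xy =>
    [p q [i [[s Vs sp] [t Vt tq]]]|p|p q r _ [b Hb] _ [c Hc]].
  - exists c0 => f /=; rewrite -sp -tq; apply: le_trans (Hc0 (f \o phi i) _ _ Vs Vt) _.
    by rewrite ler_wpM2l ?(ltW c00) // form0_le_energy1.
  - by exists 0 => f /=; rewrite subrr expr0n /= mul0r.
  - exists (2 * (b + c)) => f /=; apply: le_trans (sqr_split _ (f q) _) _.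
    by rewrite -mulrA ler_wpM2l // mulrDl; apply: lerD; [exact: Hb|exact: Hc].
have [||c Hc] := uniform_bound _ _ each.
- by apply: finite_setX; exact: Vlev1_finite.
- move=> p b c bc Hb f; apply: le_trans (Hb f) _.
  by rewrite ler_wpM2r // energy1_ge0.
exists (`|c| + 1) => [|f x y Vx Vy]; first by rewrite ltr_wpDl.
apply: le_trans (Hc (x, y) (conj Vx Vy) f) _.
by rewrite ler_wpM2r ?energy1_ge0 // (le_trans (ler_norm c)) // lerDl.
Qed.

(** The infimum in the renormalization identity bounds the energy of every
    extension from below, in particular that of f itself. *)
Lemma form0_le f : form0 f f <= rho * energy1 f.
Proof.
rewrite -ler_pdivrMl ?rho_gt0 // -(hs_renormalization hs).
apply: ge_inf; last by exists f.
by exists 0 => _ [g _ <-]; exact: energy1_ge0.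
Qed.

(** The energies form_lev by recursion on the level, splitting off the first
    letter of a word: self-similarity is built in. *)
Fixpoint level_energy m f g : R :=
  if m is m'.+1 then rho * \sum_i level_energy m' (f \o phi i) (g \o phi i)
  else form0 f g.
Local Notation energy := level_energy.

Lemma form_levE m f g : form_lev F S m f g = energy m f g.
Proof.
elim: m f g => [|m IH] f g.
  rewrite /form_lev expr0 mul1r (bigD1 [tuple]) //= big1 ?addr0 // => t.
  by move=> /eqP[]; exact: tuple0.
rewrite /= /form_lev exprS -mulrA; congr (_ * _).
under [RHS]eq_bigr do rewrite -IH /form_lev; rewrite -[RHS]mulr_sumr; congr (_ * _).
rewrite pair_big /= (reindex (fun p : 'I_M * m.-tuple 'I_M => [tuple of p.1 :: p.2])).
  by apply: eq_bigr => -[i w] _.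
exists (fun t : m.+1.-tuple 'I_M => (thead t, [tuple of behead t])) => [[i w]|t] _ /=.
  by congr pair; apply: val_inj.
by rewrite -tuple_eta.
Qed.

Lemma energy_sym m f g : energy m f g = energy m g f.
Proof.
elim: m f g => [|m IH] f g; first exact: form0_sym.
by congr (_ * _); apply: eq_bigr => i _; apply: IH.
Qed.

Lemma energy_lin m c f g h :
  energy m (axpy c f g) h = c * energy m f h + energy m g h.
Proof.
elim: m f g h => [|m IH] f g h /=; first exact: form0_lin.
rewrite mulrCA -mulrDr; congr (_ * _); rewrite mulr_sumr -big_split /=.
by apply: eq_bigr => i _; apply: IH.
Qed.

Lemma energy_linr m c f g h :
  energy m h (axpy c f g) = c * energy m h f + energy m h g.
Proof. by rewrite energy_sym energy_lin !(energy_sym m h). Qed.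

Lemma energy_ext m f g h c : (forall x, K x -> f x = g x + c) ->
  energy m f h = energy m g h.
Proof.
elim: m f g h => [|m IH] f g h fg /=.
  by apply: (@form0_ext f g h c) => x Vx; apply: fg; exact: V0_attractor Vx.
congr (_ * _); apply: eq_bigr => i _; apply: IH => x Kx /=.
by apply: fg; exact: maps_attractor.
Qed.

Lemma energy_ext2 m f g c : (forall x, K x -> f x = g x + c) ->
  energy m f f = energy m g g.
Proof.
by move=> fg; rewrite (energy_ext _ _ fg) energy_sym (energy_ext _ _ fg).
Qed.

Lemma energy_ge0 m f : 0 <= energy m f f.
Proof.
elim: m f => [|m IH] f /=; first exact: form0_ge0.
by rewrite mulr_ge0 ?(ltW rho_gt0) // sumr_ge0.
Qed.

Lemma energyS_le m f : energy m f f <= energy m.+1 f f.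
Proof.
elim: m f => [|m IH] f; first exact: form0_le.
by rewrite /= ler_pM2l ?rho_gt0 // ler_sum.
Qed.

Lemma energy_mono k m f : (k <= m)%N -> energy k f f <= energy m f f.
Proof.
move=> /subnK<-; elim: (m - k)%N => // n IH.
exact: le_trans IH (energyS_le _ _).
Qed.

(** Of all words of length |w| + m, only those with prefix w are kept. *)
Lemma energy_cell w m f :
  rho ^+ size w * energy m (f \o phiw w) (f \o phiw w) <= energy (size w + m) f f.
Proof.
elim: w f => [|i w IH] f /=; first by rewrite expr0 mul1r.
rewrite exprS -mulrA ler_pM2l ?rho_gt0 //.
apply: le_trans (IH (f \o phi i)) _.
by rewrite [leRHS](bigD1 i) //= lerDl sumr_ge0 // => j _; exact: energy_ge0.
Qed.

Lemma energy_axpy m c f g : energy m (axpy c f g) (axpy c f g) =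
  c ^+ 2 * energy m f f + 2 * c * energy m f g + energy m g g.
Proof.
by rewrite energy_lin !energy_linr (energy_sym m g f); ring.
Qed.

End Energy.

(** * Oscillation of functions of finite energy *)

Section Chaining.
Variables (R : realType) (N : nat) (F : ifs R N) (S : form_data R N).
Hypotheses (nf : nested_fractal F) (hs : harmonic_structure F S).
Local Notation pt := 'rV[R]_N.
Local Notation M := (nmaps F).
Local Notation L := (scale F).
Local Notation phi := (@maps R N F).
Local Notation K := (attractor F).
Local Notation rho := (renormalization S).
Local Notation form0 := (form0 F S).
Local Notation energy := (level_energy F S).
Local Notation energy1 := (step_energy F S).
Implicit Types (x y z : pt) (w u v : seq 'I_M) (m : nat) (f g h : pt -> R).

Definition decay : R := Num.sqrt rho^-1.

Lemma decay_gt0 : 0 < decay.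
Proof. by rewrite sqrtr_gt0 invr_gt0 (rho_gt0 hs). Qed.

Lemma decay_lt1 : decay < 1.
Proof.
by rewrite -[ltRHS]sqrtr1 ltr_sqrt ?ltr01 // invf_lt1 ?(rho_gt0 hs) // (hs_rho hs).
Qed.

Lemma decay_sqr m : (decay ^+ m) ^+ 2 = rho ^- m.
Proof.
rewrite -exprM mulnC exprM sqr_sqrtr ?exprVn //.
by rewrite invr_ge0 ltW // (rho_gt0 hs).
Qed.

Lemma le_of_sqr (p q : R) : 0 <= q -> p ^+ 2 <= q ^+ 2 -> `|p| <= q.
Proof. by move=> q0 pq; rewrite -(ger0_norm q0) -ler_sqr ?nnegrE // !real_normK ?num_real. Qed.

(** Vertex values H w on the cells whose one-step refinements g have energies
    decaying like rho ^- m: the increments along a descending chain of cells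
    form a geometric series of ratio rho ^- 1/2. *)
Definition refines (H : seq 'I_M -> pt -> R) (B : R) : Prop :=
  forall w, exists g, [/\ forall x, V0 F x -> g x = H w x,
    forall i x, V0 F x -> g (phi i x) = H (rcons w i) x &
    energy1 g <= rho ^- (size w).+1 * B].

Lemma refines_oscillation : exists2 C, 0 < C & forall H B, 0 <= B -> refines H B ->
  forall w v p q, V0 F p -> V0 F q ->
  `|H (w ++ v) q - H w p| <= C * decay ^+ size w * Num.sqrt B.
Proof.
have [c c0 Hc] := poincare_V1 nf hs.
have s0 := decay_gt0; have s1 := decay_lt1; set s := decay in s0 s1 *.
have s1' : 0 < 1 - s by rewrite subr_gt0.
exists (Num.sqrt c * (1 + (1 - s)^-1)) => [|H B B0 HB w v p q Vp Vq].
  by rewrite mulr_gt0 ?sqrtr_gt0 // addr_gt0 // invr_gt0.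
have step u g : energy1 g <= rho ^- (size u).+1 * B ->
    forall x y, Vlev F 1 x -> Vlev F 1 y ->
    `|g x - g y| <= Num.sqrt c * s ^+ size u * Num.sqrt B.
  move=> gB x y Vx Vy; apply: le_of_sqr.
    by rewrite !mulr_ge0 ?sqrtr_ge0 // exprn_ge0 // ltW.
  rewrite !exprMn decay_sqr !sqr_sqrtr ?(ltW c0) // -mulrA.
  apply: le_trans (Hc g _ _ Vx Vy) _; rewrite ler_pM2l //.
  apply: le_trans gB _; rewrite ler_wpM2r // lef_pV2 ?posrE ?exprn_gt0 ?(rho_gt0 hs) //.
  by rewrite exprS ler_peMl ?exprn_ge0 ?(ltW (rho_gt0 hs)) // ltW // (hs_rho hs).
set D := Num.sqrt c * Num.sqrt B.
have D0 : 0 <= D by rewrite mulr_ge0 ?sqrtr_ge0.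
suff : `|H (w ++ v) q - H w p| <=
    D * s ^+ size w + D / (1 - s) * (s ^+ size w - s ^+ size (w ++ v)).
  move=> H1; apply: le_trans H1 _.
  have -> : Num.sqrt c * (1 + (1 - s)^-1) * s ^+ size w * Num.sqrt B =
    D * s ^+ size w + D / (1 - s) * s ^+ size w by rewrite /D; ring.
  rewrite lerD2l; apply: ler_wpM2l; first by rewrite divr_ge0 // ltW.
  by rewrite gerBl exprn_ge0 // ltW.
elim/last_ind: v q Vq => [|v i IH] q Vq.
  rewrite cats0 subrr mulr0 addr0.
  have [g [gw _ gB]] := HB w; rewrite -!gw //.
  have := step _ _ gB q p (V0_Vlev1 Vq) (V0_Vlev1 Vp).
  by rewrite /D mulrAC.
have [g [gw gwi gB]] := HB (w ++ v); rewrite -rcons_cat size_rcons.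
apply: le_trans (ler_distD (H (w ++ v) p) _ _) _.
have := IH p Vp.
have : `|H (rcons (w ++ v) i) q - H (w ++ v) p| <= D * s ^+ size (w ++ v).
  rewrite -gwi // -gw // /D mulrAC; apply: step => //; last exact: V0_Vlev1.
  by exists i => //; exists q.
set n := size (w ++ v) => H1 H2; apply: le_trans (lerD H1 H2) _.
rewrite addrCA lerD2l exprS.
have -> : D * s ^+ n = D / (1 - s) * (s ^+ n - s * s ^+ n).
  by field; rewrite gt_eqF.
by rewrite -mulrDr ler_wpM2l ?divr_ge0 ?(ltW s1') // addrC addrA subrK.
Qed.

Lemma energy_refines f B : (forall m, energy m f f <= B) ->
  refines (fun w => f \o phiw w) B.
Proof.
move=> fB w; exists (f \o phiw w); split=> // [i x _|]; first by rewrite /= phiw_rcons.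
rewrite ler_pdivlMl ?exprn_gt0 ?(rho_gt0 hs) // exprSr -mulrA.
apply: le_trans (fB (size w + 1)%N).
exact: (energy_cell nf hs w 1 f).
Qed.

(** Chaining from a fixed vertex along the cells around x: the increments at
    level m are of order rho ^- (m / 2), and rho > 1 makes them summable. *)
Lemma oscillation : exists2 C, 0 < C & forall f B, 0 <= B ->
  {within K, continuous f} -> (forall m, energy m f f <= B) ->
  forall x y, K x -> K y -> `|f x - f y| <= C * Num.sqrt B.
Proof.
have [C C0 HC] := refines_oscillation.
have [p Vp] := V0_nonempty nf.
exists (2 * C) => [|f B B0 cf fB]; first by rewrite mulr_gt0.
have near_p x : K x -> `|f x - f p| <= C * Num.sqrt B.
  move=> Kx; apply/ler_addgt0Pl => e e0.
  have [d d0 fd] := (within_continuous_distP K f).1 cf x Kx e e0.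
  have [m md] := small_scaleX nf d0.
  have [v vm xv] := cell_word nf m Kx.
  have Kp := V0_attractor nf Vp.
  apply: le_trans (ler_distD (f (phiw v p)) _ _) _; apply: lerD.
    apply/ltW/fd; first exact: phiw_attractor.
    apply: le_lt_trans md; rewrite -vm; apply: (cell_dist_le nf) => //.
    by exists p.
  have := HC _ _ B0 (energy_refines fB) [::] v p p Vp Vp.
  by rewrite expr0 mulr1.
move=> x y Kx Ky; apply: le_trans (ler_distD (f p) _ _) _.
rewrite mulrAC -mulrA mulr_natl mulr2n mulrC; apply: lerD; first exact: near_p.
by rewrite distrC; exact: near_p.
Qed.

(** The limit is the supremum of the lower bounds u n - r n, each of which lies
    below every upper bound u m + r m. *)
Lemma limit_of_rate (u r : nat -> R) :
  (forall n m, (n <= m)%N -> `|u n - u m| <= r n) ->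
  exists l, forall n, `|u n - l| <= r n.
Proof.
move=> ur; have r0 n : 0 <= r n by apply: le_trans (ur n n (leqnn n)).
have cmp n m : u n - r n <= u m + r m.
  have [nm|/ltnW mn] := leqP n m.
    by have := ur _ _ nm; have := r0 m; rewrite ler_norml => ? /andP[? ?]; lra.
  by have := ur _ _ mn; have := r0 n; rewrite ler_norml => ? /andP[? ?]; lra.
pose E := [set u n - r n | n in [set: nat]].
have hE : has_sup E.
  by split; [exists (u 0 - r 0), 0|exists (u 0 + r 0) => _ [n _ <-]].
exists (sup E) => n; rewrite ler_norml.
have h1 : u n - r n <= sup E by apply: sup_upper_bound => //; exists n.
have h2 : sup E <= u n + r n.
  by apply: sup_le_ub; [case: hE|move=> _ [m _ <-]].
by apply/andP; split; lra.
Qed.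

Lemma cvg_sum_seq (T : eqType) (s : seq T) (u : nat -> T -> R) (l : T -> R) :
  (forall t, t \in s -> (fun n => u n t) @ \oo --> l t) ->
  (fun n => \sum_(t <- s) u n t) @ \oo --> \sum_(t <- s) l t.
Proof.
elim: s => [|t s IH] ul.
  by rewrite big_nil; under eq_fun do rewrite big_nil; exact: cvg_cst.
rewrite big_cons; under eq_fun do rewrite big_cons.
apply: cvgD; first by apply: ul; rewrite mem_head.
by apply: IH => t' ts; apply: ul; rewrite inE ts orbT.
Qed.

Lemma cvg_form0 (u : nat -> pt -> R) g :
  (forall x, V0 F x -> (fun n => u n x) @ \oo --> g x) ->
  (fun n => form0 (u n) (u n)) @ \oo --> form0 g g.
Proof.
move=> ug; under eq_fun do rewrite (form0E S nf).
rewrite (form0E S nf); apply: cvgM; first exact: cvg_cst.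
apply: cvg_sum_seq => x; rewrite (mem_vs nf) => /asboolP Vx.
apply: cvg_sum_seq => y; rewrite (mem_vs nf) => /asboolP Vy.
by apply: cvgM; [apply: cvgM; [exact: cvg_cst|]|];
  apply: cvgB; apply: ug.
Qed.

(** The infimum of the renormalization identity is attained: by the
    parallelogram law a minimizing sequence is Cauchy in energy, hence
    pointwise on V1, because all its members agree on V0. *)
Lemma minimizer f : exists g, (forall x, V0 F x -> g x = f x) /\
  energy1 g = rho^-1 * form0 f f.
Proof.
have [c c0 Hc] := poincare_V1 nf hs.
pose E := [set energy1 g | g in [set g | forall x, V0 F x -> g x = f x]].
have infE : inf E = rho^-1 * form0 f f := hs_renormalization hs f.
have E0 : has_inf E.
  split; first by exists (energy1 f), f.
  by exists 0 => _ [g _ <-]; exact: (energy1_ge0 nf hs).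
have infle g : (forall x, V0 F x -> g x = f x) -> inf E <= energy1 g.
  by move=> gf; apply: ge_inf; [case: E0|exists g].
have /choice[g Hg] n : exists g, (forall x, V0 F x -> g x = f x) /\
    energy1 g < inf E + (harmonic n) ^+ 2.
  have [|_ [g gf <-] gE] := @inf_adherent _ E ((harmonic n) ^+ 2) _ E0.
    by rewrite exprn_gt0 // invr_gt0.
  by exists g.
have gf n := (Hg n).1; have gE n := (Hg n).2.
pose C := 4 * c + 1.
have rate x : Vlev F 1 x -> forall n m, (n <= m)%N -> `|g n x - g m x| <= C * harmonic n.
  move=> Vx n m nm; have [p Vp] := V0_nonempty nf.
  have h0 k : 0 < harmonic k :> R by rewrite invr_gt0.
  apply: le_of_sqr; first by rewrite mulr_ge0 ?(ltW (h0 _)) // addr_ge0 // mulr_ge0 ?ltW.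
  pose D := axpy (-1) (g m) (g n); pose A := axpy 2^-1 D (g m).
  have -> : g n x - g m x = D x - D p.
    by rewrite /D /axpy !(gf _ p) //; ring.
  apply: le_trans (Hc D _ _ Vx (V0_Vlev1 Vp)) _.
  have eD : energy1 D + 4 * energy1 A = 2 * energy1 (g n) + 2 * energy1 (g m).
    rewrite /step_energy !mulr_sumr -!big_split; apply: eq_bigr => i _ /=.
    have := energy_axpy S nf 0 2^-1 (D \o phi i) (g m \o phi i).
    have := energy_axpy S nf 0 (-1) (g m \o phi i) (g n \o phi i).
    have := energy_lin S nf 0 (-1) (g m \o phi i) (g n \o phi i) (g m \o phi i).
    rewrite /= [form0 (g n \o _) (g m \o _)]form0_sym //.
    by move=> -> -> ->; field.
  have leA : inf E <= energy1 A.
    by apply: infle => x' Vx'; rewrite /A /axpy /D /axpy !gf //; lra.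
  have hnm : harmonic m <= harmonic n :> R by rewrite lef_pV2 ?posrE // ler_nat.
  have := gE n; have := gE m.
  have := h0 n; have := h0 m.
  move: (harmonic n) (harmonic m) hnm => a b ba b0 a0 g1 g2.
  have : energy1 D <= 4 * a ^+ 2 by nra.
  move=> DD; apply: (@le_trans _ _ (c * (4 * a ^+ 2))); first by rewrite ler_pM2l.
  rewrite /C; nra.
have /choice[G HG] x : exists l, Vlev F 1 x -> forall n, `|g n x - l| <= C * harmonic n.
  have [Vx|nVx] := pselect (Vlev F 1 x); last by exists 0.
  by have [l Hl] := limit_of_rate (rate x Vx); exists l.
have cvG x : Vlev F 1 x -> (fun n => g n x) @ \oo --> G x.
  move=> Vx; apply/cvgrPdist_le => e e0.
  have : (fun n => C * harmonic n) @ \oo --> C * 0.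
    by apply: cvgM; [exact: cvg_cst|exact: cvg_harmonic].
  rewrite mulr0 => /cvgrPdist_le/(_ e e0); apply: filterS => n.
  rewrite sub0r normrN distrC => h; apply: le_trans (HG x Vx n) _.
  exact: le_trans (ler_norm _) h.
have Gf x : V0 F x -> G x = f x.
  move=> Vx; have := cvG x (V0_Vlev1 Vx).
  under eq_fun do rewrite gf //.
  by move=> /(cvg_lim (@Rhausdorff R)) <-; rewrite lim_cst.
exists G; split=> //; apply/eqP; rewrite -infE eq_le infle // andbT.
have cvE : (fun n => energy1 (g n)) @ \oo --> energy1 G.
  apply: cvg_big => [|i _]; first exact: add_continuous.
  apply: cvg_form0 => x Vx; apply: cvG; exists i => //; by exists x.
have cvI : (fun n => inf E + (harmonic n) ^+ 2) @ \oo --> inf E.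
  rewrite -[X in _ --> X]addr0 -[X in _ + X](mulr0 0).
  by apply: cvgD; [exact: cvg_cst|apply: cvgM; exact: cvg_harmonic].
rewrite -(cvg_lim (@Rhausdorff R) cvE) -(cvg_lim (@Rhausdorff R) cvI).
apply: ler_lim; [by apply/cvg_ex; exists (energy1 G)|by apply/cvg_ex; exists (inf E)|].
by apply: nearW => n; apply: ltW.
Qed.

End Chaining.

(** * Existence of harmonic extensions *)

Section HarmonicExtension.
Variables (R : realType) (N : nat) (F : ifs R N) (S : form_data R N).
Hypotheses (nf : nested_fractal F) (hs : harmonic_structure F S).
Local Notation pt := 'rV[R]_N.
Local Notation M := (nmaps F).
Local Notation L := (scale F).
Local Notation phi := (@maps R N F).
Local Notation K := (attractor F).
Local Notation rho := (renormalization S).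
Local Notation form0 := (form0 F S).
Local Notation energy := (level_energy F S).
Local Notation energy1 := (step_energy F S).
Local Notation decay := (decay S).
Implicit Types (x y z : pt) (w u v : seq 'I_M) (m : nat) (f g h : pt -> R).

Lemma phiw_continuous w : continuous (phiw w : pt -> pt).
Proof.
move=> x U /dist_ballP[e e0 sU]; apply/dist_ballP; exists e => // y xy.
apply: sU; apply: le_lt_trans xy; rewrite dist_phiw // ler_piMl ?dist_ge0 //.
by rewrite invf_le1 ?exprn_gt0 ?(scale_gt0 nf) // exprn_ege1 // ltW // nf_scale.
Qed.

Lemma cell_closed w : closed (cell w : set pt).
Proof.
apply: compact_closed; first exact: norm_hausdorff.
apply: continuous_compact (nf_compact nf).
by apply: continuous_subspaceT; exact: phiw_continuous.
Qed.

(** The finitely many cells of level m that miss x are closed, hence at a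
    positive distance from x. *)
Lemma cell_nearby m x : K x -> exists2 d, 0 < d & forall y, K y -> dist x y < d ->
  exists w : seq 'I_M, [/\ size w = m, cell w x & cell w y].
Proof.
move=> Kx.
pose P (t : m.-tuple 'I_M) (c : R) :=
  0 < c /\ forall y, cell t y -> ~ cell t x -> c^-1 <= dist x y.
have [|||c Hc] := @uniform_bound R _ [set: m.-tuple 'I_M] P.
- exact: finite_finset.
- move=> t b c bc [b0 Hb]; have c0 : 0 < c by exact: lt_le_trans bc.
  split=> // y ty tx; apply: le_trans (Hb y ty tx).
  by rewrite lef_pV2 ?posrE.
- move=> t _; have [tx|tx] := pselect (cell t x); first by exists 1.
  have : nbhs x (~` cell t) by apply: open_nbhs_nbhs; split=> //; rewrite openC; exact: cell_closed.
  move=> /dist_ballP[e e0 He]; exists e^-1; split; first by rewrite invr_gt0.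
  by move=> y ty _; rewrite invrK leNgt; apply/negP => /He.
have c1 : 0 < Num.max c 1 by rewrite lt_max ltr01 orbT.
exists (Num.max c 1)^-1; first by rewrite invr_gt0.
move=> y Ky xy; have [w wm yw] := cell_word nf m Ky; exists w; split=> //.
apply: contrapT => xw.
have [c0 /(_ y yw xw)] := Hc (Tuple (introT eqP wm)) I.
apply/negP; rewrite -ltNge; apply: lt_le_trans xy _.
by rewrite lef_pV2 ?posrE // le_max lexx.
Qed.

Lemma wordP m x : K x -> size (word F m x) = m /\ cell (word F m x) x.
Proof.
move=> Kx; rewrite /word; case: pickP => [w /asboolP xw|H] /=.
  by rewrite size_tuple.
have [w wm xw] := cell_word nf m Kx.
by have /asboolP := H (Tuple (introT eqP wm)).
Qed.

Lemma word_cell m x : K x -> cell (word F m x) x.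
Proof. by move=> /(wordP m)[]. Qed.

Lemma size_word m x : K x -> size (word F m x) = m.
Proof. by move=> /(wordP m)[]. Qed.

Hypothesis cinj : forall w v : seq 'I_M, size w = size v -> cell w = cell v -> w = v.

Lemma cell_meet w v x : size w = size v -> w <> v -> cell w x -> cell v x ->
  (exists2 p, V0 F p & phiw w p = x) /\ (exists2 q, V0 F q & phiw v q = x).
Proof.
move=> swv wv xw xv.
have m1 : (1 <= size w)%N.
  rewrite lt0n; apply/eqP => w0; apply: wv.
  by rewrite (size0nil w0) [v]size0nil // -swv.
have cwv : cell w <> cell v by move=> /(cinj swv).
have [] : ((phiw w @` V0 F) `&` (phiw v @` V0 F)) x.
  by rewrite -(nf_nesting nf m1 erefl (esym swv) cwv).
by [].
Qed.

Section Construction.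
Variable refine : (pt -> R) -> pt -> R.
Hypothesis refine_V0 : forall f x, V0 F x -> refine f x = f x.
Hypothesis refine_energy : forall f, energy1 (refine f) = rho^-1 * form0 f f.

(** The values at the vertices of the cell w, pulled back to V0, of the function
    obtained from f by minimizing the energy one level at a time. *)
Definition vertex_data f w : pt -> R := foldl (fun g i => refine g \o phi i) f w.

Lemma vertex_data_rcons f w i :
  vertex_data f (rcons w i) = refine (vertex_data f w) \o phi i.
Proof. by rewrite /vertex_data foldl_rcons. Qed.

Lemma vertex_data_energy f w :
  form0 (vertex_data f w) (vertex_data f w) <= rho ^- size w * form0 f f.
Proof.
elim/last_ind: w => [|w i IH]; first by rewrite expr0 invr1 mul1r.
rewrite vertex_data_rcons size_rcons.
apply: le_trans (form0_le_energy1 nf hs _ _) _.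
by rewrite refine_energy exprS invfM -mulrA ler_pM2l // invr_gt0 (rho_gt0 hs).
Qed.

Lemma vertex_data_refines f : refines S (vertex_data f) (form0 f f).
Proof.
move=> w; exists (refine (vertex_data f w)); split.
- by move=> x; exact: refine_V0.
- by move=> i x _; rewrite vertex_data_rcons.
- rewrite refine_energy exprS invfM -mulrA ler_pM2l ?vertex_data_energy //.
  by rewrite invr_gt0 (rho_gt0 hs).
Qed.

(** A vertex q is the fixed point of its own map phi i, so it remains a vertex
    of all the cells w i ... i, with the same prescribed value. *)
Lemma vertex_data_fixed f w i q k : V0 F q -> phi i q = q ->
  vertex_data f (w ++ nseq k i) q = vertex_data f w q.
Proof.
move=> Vq iq; elim: k w => [|k IH] w; first by rewrite cats0.
by rewrite /= -cat_rcons IH vertex_data_rcons /= iq refine_V0.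
Qed.

(** Distinct cells of one level meet only in vertices of both, so the values
    prescribed cell by cell agree wherever two cells meet. *)
Lemma vertex_data_consistent f w v p q : size w = size v -> V0 F p -> V0 F q ->
  phiw w p = phiw v q -> vertex_data f w p = vertex_data f v q.
Proof.
elim/last_ind: w v p q => [|w i IH] v p q.
  by move=> /esym/size0nil-> _ _ /= ->.
case/lastP: v => [|v j]; first by rewrite size_rcons.
rewrite !size_rcons => -[swv] Vp Vq; rewrite !phiw_rcons !vertex_data_rcons /= => pq.
have [wv|/eqP wv] := eqVneq w v.
  by move: pq; rewrite wv => /(phiw_inj nf)->.
have [||[a Va wa] [b Vb vb]] := cell_meet swv wv (x := phiw w (phi i p)).
- by exists (phi i p) => //; apply: (maps_attractor nf); exact: V0_attractor.
- rewrite pq; exists (phi j q) => //; apply: (maps_attractor nf); exact: V0_attractor.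
rewrite -(phiw_inj nf wa); rewrite pq in vb; rewrite -(phiw_inj nf vb).
rewrite !refine_V0 //; apply: IH => //.
by rewrite wa pq vb.
Qed.

(** The value at x is the limit of the vertex data along the cells around x. By
    the chaining estimate the vertex data on any m-cell through x differ from it
    by O(rho ^- (m / 2)), whichever cell is chosen; this gives continuity, and
    the right values at the vertices, which lie in arbitrarily small cells. *)
Lemma vertex_data_extends f : exists h, [/\ {within K, continuous h},
  forall w x, V0 F x -> h (phiw w x) = vertex_data f w x &
  forall m, energy m h h = form0 f f].
Proof.
have [C C0 HC] := refines_oscillation nf hs.
have B0 := form0_ge0 nf hs f; have Hf := vertex_data_refines f.
have [p Vp] := V0_nonempty nf.
set D := C * Num.sqrt (form0 f f).
have D0 : 0 <= D by rewrite mulr_ge0 ?sqrtr_ge0 // ltW.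
have s0 := decay_gt0 hs; have s1 := decay_lt1 hs.
have osc w v a b : V0 F a -> V0 F b ->
    `|vertex_data f (w ++ v) b - vertex_data f w a| <= D * decay ^+ size w.
  by move=> Va Vb; rewrite /D mulrAC; apply: HC.
have near w v x a b : size w = size v -> cell w x -> cell v x -> V0 F a -> V0 F b ->
    `|vertex_data f w a - vertex_data f v b| <= 2 * D * decay ^+ size w.
  move=> swv xw xv Va Vb; have E0 : 0 <= D * decay ^+ size w.
    by rewrite mulr_ge0 // exprn_ge0 // ltW.
  have [wv|/eqP wv] := eqVneq w v.
    have := osc w [::] b a Vb Va; rewrite cats0 wv => h; rewrite -wv in h *.
    by rewrite -mulrA; lra.
  have [[a' Va' wa'] [b' Vb' vb']] := cell_meet swv wv xw xv.
  have e : vertex_data f w a' = vertex_data f v b'.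
    by apply: vertex_data_consistent => //; rewrite wa' vb'.
  have := osc w [::] a' a Va' Va; have := osc v [::] b b' Vb Vb'.
  rewrite !cats0 -swv e -mulrA => h1 h2.
  by apply: le_trans (ler_distD (vertex_data f v b') _ _) _; lra.
pose val x n := vertex_data f (word F n x) p.
have rate x : K x -> forall n m, (n <= m)%N ->
    `|val x n - val x m| <= 3 * D * decay ^+ n.
  move=> Kx n m nm; rewrite /val.
  have [sn xn] := wordP n Kx; have [sm xm] := wordP m Kx.
  set v := word F m x in sm xm *; rewrite -(cat_take_drop n v).
  have st : size (take n v) = n by rewrite size_take_min sm; apply/minn_idPl.
  have xt : cell (take n v) x.
    by apply: (cell_cat nf (v := drop n v)); rewrite cat_take_drop.
  have h1 := near (word F n x) (take n v) x p p (etrans sn (esym st)) xn xt Vp Vp.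
  have h2 := osc (take n v) (drop n v) p p Vp Vp.
  rewrite sn in h1; rewrite st distrC in h2.
  by apply: le_trans (ler_distD (vertex_data f (take n v) p) _ _) _; lra.
have /choice[h Hh] x : exists l, K x -> forall n, `|val x n - l| <= 3 * D * decay ^+ n.
  have [Kx|nKx] := pselect (K x); last by exists 0.
  by have [l Hl] := limit_of_rate (rate x Kx); exists l.
have close w x q : cell w x -> V0 F q ->
    `|vertex_data f w q - h x| <= 5 * D * decay ^+ size w.
  move=> xw Vq; have Kx : K x := cell_sub nf xw.
  have [sn xn] := wordP (size w) Kx.
  have h1 := near w (word F (size w) x) x q p (esym sn) xw xn Vq Vp.
  have h2 := Hh x Kx (size w).
  by apply: le_trans (ler_distD (vertex_data f (word F (size w) x) p) _ _) _; rewrite /val in h2; lra.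
have small e : 0 < e -> exists m, 5 * D * decay ^+ m < e.
  move=> e0; have D1 : 0 < 5 * D + 1 by lra.
  have [||m Hm] := @small_expr R decay (e / (5 * D + 1)).
  - by rewrite s1 ltW.
  - by rewrite divr_gt0.
  exists m; rewrite ltr_pdivlMr // mulrC in Hm; apply: le_lt_trans Hm.
  by rewrite ler_wpM2r ?exprn_ge0 ?(ltW s0) // lerDl.
have vert w x : V0 F x -> h (phiw w x) = vertex_data f w x.
  move=> Vx; have [i [ix _]] := Vx.
  apply/eqP; rewrite -subr_eq0 -normr_le0; apply/ler_addgt0Pl => e e0; rewrite addr0.
  have [m Hm] := small e e0.
  have := close (w ++ nseq m i) (phiw w x) x.
  rewrite (vertex_data_fixed _ _ _ Vx ix) distrC => close1.
  apply: le_trans (close1 _ Vx) _.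
    exists x; first exact: V0_attractor.
    by rewrite phiw_cat (phiw_nseq_fixed _ ix).
  apply: le_trans (ltW Hm); rewrite size_cat size_nseq.
  apply: ler_wpM2l; first by rewrite mulr_ge0.
  by rewrite ler_wiXn2l ?(ltW s0) ?(ltW s1) // leq_addl.
exists h; split=> //.
- apply/within_continuous_distP => x Kx e e0.
  have [m Hm] : exists m, 5 * D * decay ^+ m < e / 2 by apply: small; rewrite divr_gt0.
  have [d d0 Hd] := cell_nearby m Kx; exists d => // y Ky xy.
  have [w [wm xw yw]] := Hd y Ky xy.
  have h1 := close w x p xw Vp; have h2 := close w y p yw Vp.
  rewrite wm distrC in h1; rewrite wm in h2.
  by apply: le_lt_trans (ler_distD (vertex_data f w p) _ _) _; lra.
- suff H m w : energy m (h \o phiw w) (h \o phiw w) =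
      form0 (vertex_data f w) (vertex_data f w).
    by move=> m; exact: (H m [::]).
  elim: m w => [|m IH] w /=.
    have e x : V0 F x -> (h \o phiw w) x = vertex_data f w x + 0.
      by move=> Vx; rewrite /= vert // addr0.
    have ext g : form0 (h \o phiw w) g = form0 (vertex_data f w) g.
      exact: (form0_ext S nf) e.
    by rewrite ext (form0_sym S nf) ext.
  under eq_bigr => i _ do
    rewrite -[(h \o phiw w) \o phi i]/(h \o (phiw w \o phi i)) -phiw_rconsE IH vertex_data_rcons.
  by rewrite -/(step_energy F S _) refine_energy mulrA divff ?mul1r // gt_eqF // (rho_gt0 hs).
Qed.

End Construction.

Lemma harmonic_extension f : exists h, [/\ {within K, continuous h},
  forall x, V0 F x -> h x = f x & forall m, energy m h h = form0 f f].
Proof.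
have /choice[refine Hr] g := minimizer nf hs g.
have [h [ch hw eh]] :=
  vertex_data_extends (fun g => (Hr g).1) (fun g => (Hr g).2) f.
by exists h; split=> // x Vx; exact: (hw [::] x Vx).
Qed.

End HarmonicExtension.

(** * Harmonic functions in coordinates *)

Section Harmonic.
Variables (R : realType) (N : nat) (F : ifs R N) (S : form_data R N).
Hypotheses (nf : nested_fractal F) (hs : harmonic_structure F S).
Local Notation pt := 'rV[R]_N.
Local Notation M := (nmaps F).
Local Notation phi := (@maps R N F).
Local Notation K := (attractor F).
Local Notation rho := (renormalization S).
Local Notation form0 := (form0 F S).
Local Notation form := (Defs.form F S).
Local Notation energy := (level_energy F S).
Implicit Types (x y z : pt) (w u v : seq 'I_M) (m : nat) (f g h : pt -> R).

Hypothesis cinj : forall w v : seq 'I_M, size w = size v -> cell w = cell v -> w = v.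

Lemma form_stationary f g : (forall m, energy m f g = form0 f g) -> form f g = form0 f g.
Proof.
move=> H; rewrite /Defs.form; under eq_fun do rewrite form_levE H.
by rewrite lim_cst.
Qed.

Lemma energy_le_form m f : dom_form F S f -> energy m f f <= form f f.
Proof.
move=> [_ ub]; rewrite -form_levE; apply: nondecreasing_cvgn_le.
  by apply/nondecreasing_seqP => k; rewrite !form_levE; exact: energyS_le.
apply: nondecreasing_is_cvgn ub.
by apply/nondecreasing_seqP => k; rewrite !form_levE; exact: energyS_le.
Qed.

(** These turn out to be exactly the harmonic functions (harmonicP). Unlike the
    minimization property, constancy of the energies visibly passes to linear
    combinations and to the pieces h o phi i. *)
Definition stationary h : Prop :=
  {within K, continuous h} /\ forall m, energy m h h = form0 h h.

Lemma stationary_dom h : stationary h -> dom_form F S h.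
Proof.
by move=> [ch eh]; split=> //; exists (form0 h h) => _ [m _ <-]; rewrite form_levE eh.
Qed.

Lemma form0_ext2 f g : (forall x, V0 F x -> f x = g x) -> form0 f f = form0 g g.
Proof.
move=> fg; have fg0 x : V0 F x -> f x = g x + 0 by rewrite addr0; exact: fg.
have ext k : form0 f k = form0 g k by exact: (form0_ext S nf) fg0.
by rewrite ext (form0_sym S nf) ext.
Qed.

(** Comparison with the harmonic extension already constructed, whose energy is
    that of level 0. *)
Lemma minimal_extension_stationary f h : minimal_extension F S f h -> stationary h.
Proof.
move=> [dh hf hmin]; have [g [cg gf eg]] := harmonic_extension nf hs cinj f.
have eg' m : energy m g g = form0 g g by rewrite eg; apply: form0_ext2 => x /gf.
have le1 : form h h <= form0 h h.
  apply: le_trans (hmin g _ gf) _; first exact: stationary_dom.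
  rewrite form_stationary // (@form0_ext2 g h) // => x Vx.
  by rewrite gf // hf.
split; first by case: dh.
move=> m; apply/eqP; rewrite eq_le (energy_mono nf hs _ (leq0n m)) andbT.
exact: le_trans (energy_le_form m dh) le1.
Qed.

Lemma stationary_minimal f h : stationary h -> (forall x, V0 F x -> h x = f x) ->
  minimal_extension F S f h.
Proof.
move=> sh hf; split=> //; first exact: stationary_dom.
move=> g dg gf; rewrite form_stationary; last by case: sh.
apply: le_trans (energy_le_form 0 dg); rewrite (@form0_ext2 h g) // => x Vx.
by rewrite hf // gf.
Qed.

Lemma harmonicP h : Defs.harmonic F S h <-> stationary h.
Proof.
by split=> [/minimal_extension_stationary|sh]; last exact: stationary_minimal.
Qed.

Lemma Hext_spec f : stationary (Hext F S f) /\ forall x, V0 F x -> Hext F S f x = f x.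
Proof.
have [g [cg gf eg]] := harmonic_extension nf hs cinj f.
have mg : minimal_extension F S f g.
  apply: stationary_minimal => //; split=> // m.
  by rewrite eg; apply: form0_ext2 => x /gf.
rewrite /Hext; case: xgetP => [h _ /= mh|/(_ g)//].
by split; [exact: minimal_extension_stationary mh|case: mh].
Qed.

Lemma stationary_axpy c f g : stationary f -> stationary g -> stationary (axpy c f g).
Proof.
move=> [cf ef] [cg eg]; split.
  by move=> x; apply: cvgD; [apply: cvgM; [exact: cvg_cst|exact: cf]|exact: cg].
move=> m.
(* The energies of f + c g and f - c g are nondecreasing in the level, and
   their sum is constant by the parallelogram law. *)
have h1 := energy_mono nf hs (axpy c f g) (leq0n m).
have h2 := energy_mono nf hs (axpy (- c) f g) (leq0n m).
have e1 := energy_axpy S nf m c f g; have e2 := energy_axpy S nf m (- c) f g.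
have e3 := energy_axpy S nf 0 c f g; have e4 := energy_axpy S nf 0 (- c) f g.
rewrite -[RHS]/(energy 0 (axpy c f g) (axpy c f g)).
rewrite e1 e2 e3 e4 in h1 h2 *; rewrite !ef !eg in h1 h2 *.
by apply/eqP; rewrite eq_le h1 andbT; rewrite sqrrN !mulrN in h2; lra.
Qed.

Lemma stationary_form0 m f g : stationary f -> stationary g -> energy m f g = form0 f g.
Proof.
move=> sf sg; have [_ e] := stationary_axpy 1 sf sg.
have := e m; rewrite -[RHS]/(energy 0 (axpy 1 f g) (axpy 1 f g)).
by rewrite !(energy_axpy S nf) /= (sf.2 m) (sg.2 m) => ?; lra.
Qed.

Lemma stationary_form f g : stationary f -> stationary g -> form f g = form0 f g.
Proof. by move=> sf sg; apply: form_stationary => m; apply: stationary_form0. Qed.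

Lemma stationary_selfsimilar f g : stationary f -> stationary g ->
  form0 f g = rho * \sum_i form0 (f \o phi i) (g \o phi i).
Proof. by move=> sf sg; rewrite -(stationary_form0 1 sf sg). Qed.

Lemma comp_phiw_continuous w f :
  {within K, continuous f} -> {within K, continuous (f \o phiw w)}.
Proof.
move=> /within_continuous_distP cf; apply/within_continuous_distP => x Kx e e0.
have [d d0 sd] := cf _ (phiw_attractor nf w Kx) e e0; exists d => // y Ky xy.
apply: sd; first exact: phiw_attractor.
apply: le_lt_trans xy; rewrite dist_phiw // ler_piMl ?dist_ge0 //.
by rewrite invf_le1 ?exprn_gt0 ?(scale_gt0 nf) // exprn_ege1 // ltW // nf_scale.
Qed.

(** The energies of the pieces h o phi i are nondecreasing in the level and
    their sum is constant, so each of them is constant. *)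
Lemma stationary_comp w h : stationary h -> stationary (h \o phiw w).
Proof.
elim: w h => [//|i w IH] h sh; apply: (IH (h \o phi i)); case: sh => ch eh.
split=> [|m]; first exact: (@comp_phiw_continuous [:: i] h ch).
have e k : \sum_j energy k (h \o phi j) (h \o phi j) = rho^-1 * form0 h h.
  by rewrite -(eh k.+1) /= mulrA mulVf ?mul1r // gt_eqF // (rho_gt0 hs).
have := etrans (e m) (esym (e 0)) => /eqP; rewrite -subr_eq0 -sumrB => /eqP e0.
have /psumr_eq0P/(_ e0 i isT)/eqP : forall j, true ->
    0 <= energy m (h \o phi j) (h \o phi j) - energy 0 (h \o phi j) (h \o phi j).
  by move=> j _; rewrite subr_ge0 energy_mono.
by rewrite subr_eq0 => /eqP.
Qed.

Lemma stationary_ext f g c : (forall x, K x -> f x = g x + c) ->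
  stationary f -> stationary g.
Proof.
move=> fg [cf ef]; split.
  have : {within K, continuous (fun x => f x - c)}.
    by move=> x; apply: cvgB; [exact: cf|exact: cvg_cst].
  by apply: within_continuous_eq => x Kx; rewrite fg // addrK.
by move=> m; rewrite -(energy_ext2 S nf m fg) ef; exact: (energy_ext2 S nf 0 fg).
Qed.

Lemma energy_cst m c g : energy m (cst c) g = 0.
Proof.
elim: m g => [|m IH] g /=.
  by rewrite (form0E S nf) big1 ?mulr0 // => x _; rewrite big1 // => y _;
    rewrite subrr mulr0 mul0r.
by rewrite big1 ?mulr0 // => i _; exact: IH.
Qed.

Lemma stationary_cst c : stationary (cst c).
Proof.
split=> [|m]; first by move=> x; exact: cvg_cst.
by rewrite energy_cst -[form0 _ _]/(energy 0 _ _) energy_cst.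
Qed.

Let vs : seq pt := finmap.enum_fset (fset_set (V0 F)).

Lemma sum_V0E f : \sum_(x \in V0 F) f x = \sum_(x <- vs) f x.
Proof. by rewrite fsbig_finite //; exact: V0_finite. Qed.

Lemma ipH_cst h c : stationary h -> ipH F S h (cst c) =
  (\sum_(x <- vs) h x) * (c * (size vs)%:R).
Proof.
move=> sh; rewrite /ipH (stationary_form sh (stationary_cst c)) !sum_V0E.
rewrite (form0_sym S nf) -[Defs.form0 _ _ _ _]/(energy 0 _ _) energy_cst add0r.
by rewrite big_const_seq count_predT iter_addr_0 mulr_natr.
Qed.

Lemma card_V0_neq0 : (size vs)%:R != 0 :> R.
Proof.
have [x Vx] := V0_nonempty nf.
have : x \in vs by rewrite (mem_vs nf); apply/asboolP.
by case: vs => // a s _; rewrite pnatr_eq0.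
Qed.

Lemma Ptilde_shift h : exists c, forall x, Ptilde F S h x = h x + c.
Proof. by exists (- (ipH F S h (cst 1) / ipH F S (cst 1) (cst 1))). Qed.

(** Subtracting a constant makes the sum over V0 vanish, and this is all that
    orthogonality to the constants asks for. *)
Lemma Ptilde_Htilde h : stationary h -> Htilde F S (Ptilde F S h).
Proof.
move=> sh; have [c hc] := Ptilde_shift h.
have sP : stationary (Ptilde F S h).
  by apply: (@stationary_ext h _ (- c)) sh => x _; rewrite hc addrK.
split=> [|d]; first exact/harmonicP.
rewrite ipH_cst //; apply/eqP; rewrite mulf_eq0; apply/orP; left; apply/eqP.
rewrite /Ptilde ipH_cst // ipH_cst; last exact: stationary_cst.
rewrite sumrB big_const_seq count_predT iter_addr_0.
rewrite [X in _ / (X * _)]big_const_seq count_predT iter_addr_0 mul1r.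
rewrite -[_ *+ size vs]mulr_natr; field.
by rewrite card_V0_neq0.
Qed.

Lemma Htilde_stationary h : Htilde F S h -> stationary h.
Proof. by move=> [/harmonicP]. Qed.

Lemma Mtildew_spec w h : Htilde F S h -> Htilde F S (Mtildew S w h) /\
  exists c, forall x, Mtildew S w h x = h (phiw w x) + c.
Proof.
elim: w h => [|i w IH] h Hh; first by split=> //; exists 0 => x; rewrite addr0.
have HM : Htilde F S (Mtilde S i h).
  by apply/Ptilde_Htilde/(stationary_comp [:: i])/Htilde_stationary.
have [H1 [c Hc]] := IH _ HM; split=> //.
have [b Hb] := Ptilde_shift (h \o phi i).
by exists (b + c) => x; rewrite /= Hc /Mtilde Hb /= addrA.
Qed.

Lemma form0_sum (I : Type) (s : seq I) (c : I -> R) (e : I -> pt -> R) g :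
  form0 (fun x => \sum_(i <- s) c i * e i x) g = \sum_(i <- s) c i * form0 (e i) g.
Proof.
elim: s => [|i s IH].
  rewrite big_nil (_ : (fun x => _) = cst 0); last first.
    by apply/funext => x; rewrite big_nil.
  exact: (energy_cst 0).
rewrite big_cons -IH -(form0_lin S nf); congr (form0 _ g).
by apply/funext => x; rewrite big_cons.
Qed.

Section Coordinates.
Variables (n : nat) (e : 'I_n -> pt -> R).
Hypothesis he : orthonormal_basis F S e.
Implicit Types (a b : 'cV[R]_n).

Let He i : Htilde F S (e i).
Proof. by case: he. Qed.

Let se i : stationary (e i).
Proof. exact: Htilde_stationary. Qed.

Let form0_e i j : form0 (e i) (e j) = (i == j)%:R.
Proof. by case: he => _ <- _; rewrite stationary_form. Qed.

Lemma expansion h : Htilde F S h ->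
  forall x, K x -> h x = \sum_i form0 h (e i) * e i x.
Proof.
move=> Hh; have [_ _ /(_ h Hh)[c hc]] := he.
suff ce i : form0 h (e i) = c i by move=> x Kx; rewrite hc //; apply: eq_bigr => i _; rewrite ce.
have hc0 x : V0 F x -> h x = \sum_i c i * e i x + 0.
  by move=> Vx; rewrite addr0 hc //; exact: V0_attractor.
rewrite (form0_ext S nf _ hc0) form0_sum (bigD1 i) //= form0_e eqxx mulr1.
by rewrite big1 ?addr0 // => j ji; rewrite form0_e (negbTE ji) mulr0.
Qed.

(** The constant c and the composition are there for the sake of the operators
    Mtilde w, which are composition with phiw w up to constants. *)
Lemma form0_expansion w (c : R) h k g : Htilde F S h ->
  (forall x, K x -> k x = h x + c) ->
  form0 (k \o phiw w) g = \sum_i form0 h (e i) * form0 (e i \o phiw w) g.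
Proof.
move=> Hh kh; rewrite -form0_sum.
have ext x : V0 F x ->
    (k \o phiw w) x = \sum_i form0 h (e i) * (e i \o phiw w) x + c.
  move=> Vx /=; have Kx : K (phiw w x) by apply: (phiw_attractor nf); exact: V0_attractor.
  by rewrite kh // -expansion.
exact: (form0_ext S nf) ext.
Qed.

Lemma parseval h g : Htilde F S h ->
  form0 h g = \sum_i form0 h (e i) * form0 (e i) g.
Proof.
move=> Hh; apply: (@form0_expansion [::] 0 h h g Hh) => x _.
by rewrite addr0.
Qed.

Lemma MmxE w i j : Mmx S e w i j = form0 (e j \o phiw w) (e i).
Proof.
rewrite mxE; have [H [c Hc]] := Mtildew_spec w (He j).
rewrite stationary_form //; last exact: Htilde_stationary.
exact: (form0_ext S nf) (fun x _ => Hc x).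
Qed.

Lemma Mmx_cons i w : Mmx S e (i :: w) = Mmx S e w *m Mmx S e [:: i].
Proof.
apply/matrixP => k j; rewrite MmxE mxE.
have [H [c Hc]] := Mtildew_spec [:: i] (He j).
rewrite -[e j \o phiw (i :: w)]/((e j \o phi i) \o phiw w).
rewrite (@form0_expansion w (- c) (Mtildew S [:: i] (e j))) //; last first.
  by move=> x _; rewrite Hc addrK.
apply: eq_bigr => l _; rewrite !MmxE mulrC; congr (_ * _).
exact: (form0_ext S nf) (fun x _ => Hc x).
Qed.

(** Each Mtilde i is surjective on Htilde, so its matrix has a right inverse,
    which suffices for a square matrix. *)
Lemma Mmx_unit w : nondegenerate_structure F S -> Mmx S e w \in unitmx.
Proof.
move=> nd; elim: w => [|i w IH].
  have -> : Mmx S e ([::] : seq 'I_M) = 1%:M.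
    by apply/matrixP => i j; rewrite MmxE mxE /= eq_sym -form0_e.
  exact: unitmx1.
rewrite Mmx_cons unitmx_mul IH /=.
have [inv Hinv] := nd i.
pose X : 'M[R]_n := \matrix_(l, j) form0 (inv (e j)) (e l).
suff /mulmx1_unit[] : Mmx S e [:: i] *m X = 1%:M by [].
apply/matrixP => k j; rewrite !mxE.
have [Hi Mi _] := Hinv _ (He j).
rewrite -[RHS](form0_e k j) (form0_sym S nf (e k)).
have [c Hc] := Ptilde_shift (inv (e j) \o phi i).
have ext x : V0 F x -> e j x = (inv (e j) \o phiw [:: i]) x + c.
  by move=> Vx; rewrite -(Mi x (V0_attractor nf Vx)); exact: Hc.
rewrite (form0_ext S nf _ ext) (@form0_expansion [:: i] 0 (inv (e j))) //; last first.
  by move=> x _; rewrite addr0.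
by apply: eq_bigr => l _; rewrite MmxE mxE mulrC.
Qed.

(** Parseval for e i o phiw w, which is in Htilde up to a constant. *)
Lemma GramE w i j : Gram S e w i j = form0 (e i \o phiw w) (e j \o phiw w).
Proof.
have [H [c Hc]] := Mtildew_spec w (He i).
rewrite -(form0_ext S nf _ (fun x (_ : V0 F x) => Hc x)) parseval // mxE.
apply: eq_bigr => k _; rewrite [_^T _ _]mxE !MmxE; congr (_ * _).
  by rewrite (form0_ext S nf _ (fun x (_ : V0 F x) => Hc x)).
exact: form0_sym.
Qed.

Lemma Gram_rcons w : Gram S e w = rho *: \sum_i Gram S e (rcons w i).
Proof.
apply/matrixP => k l; rewrite [RHS]mxE summxE GramE.
rewrite (stationary_selfsimilar (stationary_comp w (se k)) (stationary_comp w (se l))).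
by congr (_ * _); apply: eq_bigr => i _; rewrite GramE phiw_rconsE.
Qed.

Lemma qform_Gram w a : qform (Gram S e w) a = \sum_k ((Mmx S e w *m a) k 0) ^+ 2.
Proof.
rewrite /qform /Gram mulmxA -trmx_mul -mulmxA mxE.
by apply: eq_bigr => k _; rewrite mxE expr2.
Qed.

Lemma qform_Gram_ge0 w a : 0 <= qform (Gram S e w) a.
Proof. by rewrite qform_Gram; apply: sumr_ge0 => k _; exact: sqr_ge0. Qed.

Lemma trace_Gram w : \tr (Gram S e w) = \sum_k \sum_j (Mmx S e w k j) ^+ 2.
Proof.
rewrite exchange_big /=; apply: eq_bigr => j _; rewrite mxE.
by apply: eq_bigr => k _; rewrite mxE expr2.
Qed.

Lemma trace_Gram_ge0 w : 0 <= \tr (Gram S e w).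
Proof.
by rewrite trace_Gram; apply: sumr_ge0 => k _; apply: sumr_ge0 => j _; exact: sqr_ge0.
Qed.

(** A bound for the quadratic forms of all positive matrices of trace at most 1
    at the vector a, cruder than the squared norm but obtained entrywise. *)
Definition mass a : R := n%:R * (\sum_j `|a j 0|) ^+ 2.

Lemma qform_Gram_le w a : qform (Gram S e w) a <= \tr (Gram S e w) * mass a.
Proof.
rewrite qform_Gram /mass; set t := \tr _.
have t0 : 0 <= t by exact: trace_Gram_ge0.
have Mt k j : `|Mmx S e w k j| <= Num.sqrt t.
  apply: le_of_sqr; rewrite ?sqrtr_ge0 // sqr_sqrtr // /t trace_Gram.
  rewrite (bigD1 k) //= (bigD1 j) //= -addrA lerDl addr_ge0 //.
    by apply: sumr_ge0 => i _; exact: sqr_ge0.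
  by apply: sumr_ge0 => i _; apply: sumr_ge0 => i' _; exact: sqr_ge0.
apply: (@le_trans _ _ (\sum_(k < n) (t * (\sum_j `|a j 0|) ^+ 2))).
  apply: ler_sum => k _; rewrite -[t in leRHS]sqr_sqrtr // -exprMn.
  rewrite -[leLHS]real_normK ?num_real //.
  rewrite ler_pXn2r ?nnegrE ?mulr_ge0 ?sqrtr_ge0 ?sumr_ge0 //.
  rewrite mxE; apply: le_trans (ler_norm_sum _ _ _) _; rewrite mulr_sumr.
  by apply: ler_sum => j _; rewrite normrM ler_wpM2r.
by rewrite sumr_const card_ord -[leLHS]mulr_natl mulrCA.
Qed.

Lemma coords_Ptilde_Hext g :
  \sum_k (coords F S e (Ptilde F S (Hext F S g)) k 0) ^+ 2 = form0 g g.
Proof.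
have [sH Hg] := Hext_spec g; have HP := Ptilde_Htilde sH.
have [c Hc] := Ptilde_shift (Hext F S g).
have ext x : V0 F x -> Ptilde F S (Hext F S g) x = g x + c.
  by move=> Vx; rewrite Hc Hg.
have ext2 k : form0 (Ptilde F S (Hext F S g)) k = form0 g k by exact: (form0_ext S nf) ext.
rewrite -ext2 (form0_sym S nf) -ext2 parseval //.
apply: eq_bigr => k _; rewrite mxE stationary_form //; last exact: Htilde_stationary.
by rewrite expr2 [in RHS](form0_sym S nf (e k)).
Qed.

(** The inverse of Mmx in the gradient cancels the factor Mmx of the Gram
    matrix, and Parseval identifies the remaining sum of squares. *)
Lemma qform_gradient w g : nondegenerate_structure F S ->
  qform (Gram S e w)
    (invmx (Mmx S e w) *m coords F S e (Ptilde F S (Hext F S g))) = form0 g g.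
Proof.
move=> nd; rewrite qform_Gram mulmxA mulmxV ?Mmx_unit // mul1mx.
exact: coords_Ptilde_Hext.
Qed.

End Coordinates.
End Harmonic.

(** * The Kusuoka measure and the energy of a cell *)

Section QuadraticForm.
Variables (R : realType) (n : nat).
Implicit Types (Z : 'M[R]_n) (a b : 'cV[R]_n).

Lemma qformE Z a : qform Z a = \sum_j (\sum_i a i 0 * Z i j) * a j 0.
Proof.
rewrite /qform mxE; apply: eq_bigr => j _; congr (_ * _).
by rewrite mxE; apply: eq_bigr => i _; rewrite mxE.
Qed.

Lemma qformZ (c : R) Z a : qform (c *: Z) a = c * qform Z a.
Proof. by rewrite /qform -scalemxAr -scalemxAl mxE. Qed.

Lemma qform_sum (I : Type) (s : seq I) (Z : I -> 'M[R]_n) a :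
  qform (\sum_(i <- s) Z i) a = \sum_(i <- s) qform (Z i) a.
Proof. by rewrite /qform mulmx_sumr mulmx_suml summxE. Qed.

Lemma qform_parallelogram Z a b :
  qform Z (a + b) + qform Z (a - b) = 2 * qform Z a + 2 * qform Z b.
Proof.
rewrite /qform [(a + b)^T]raddfD [(a - b)^T]raddfB /=.
rewrite !(mulmxDl, mulmxDr, mulNmx, mulmxN).
move: (a^T *m Z *m a) (a^T *m Z *m b) (b^T *m Z *m a) (b^T *m Z *m b) => p q r s.
by rewrite !mxE; ring.
Qed.

Lemma qform_le Z a b : (forall c, 0 <= qform Z c) ->
  qform Z a <= 2 * qform Z b + 2 * qform Z (a - b).
Proof.
move=> Z0; have := qform_parallelogram Z b (a - b).
by rewrite [b + (a - b)]addrC subrK; have := Z0 (b - (a - b)); lra.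
Qed.

Lemma cvg_qform (Zs : nat -> 'M[R]_n) Z a :
  (forall i j, (fun m => Zs m i j) @ \oo --> Z i j) ->
  (fun m => qform (Zs m) a) @ \oo --> qform Z a.
Proof.
move=> ZZ; under eq_fun do rewrite qformE; rewrite qformE.
apply: cvg_sum_seq => j _; apply: cvgM; last exact: cvg_cst.
by apply: cvg_sum_seq => i _; apply: cvgM; [exact: cvg_cst|exact: ZZ].
Qed.

Lemma measurable_qform d (T : measurableType d) (D : set T) (Z : T -> 'M[R]_n)
    (v : T -> 'cV[R]_n) :
  (forall i j, measurable_fun D (fun x => Z x i j)) ->
  (forall i, measurable_fun D (fun x => v x i 0)) ->
  measurable_fun D (fun x => qform (Z x) (v x)).
Proof.
move=> mZ mv; under eq_fun do rewrite qformE.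
apply: measurable_sum => j; apply: measurable_funM => //.
apply: measurable_sum => i; exact: measurable_funM.
Qed.

End QuadraticForm.

(** The integrands below are known to be nonnegative only almost everywhere;
    this moves all integrals to a set where they are so everywhere. *)
Lemma integral_full_subset d (T : measurableType d) (R : realType)
    (mu : {measure set T -> \bar R}) (A D : set T) (f : T -> \bar R) :
  measurable A -> measurable D -> measurable_fun A f -> mu (A `\` D) = 0%E ->
  (\int[mu]_(x in A) f x = \int[mu]_(x in A `&` D) f x)%E.
Proof.
move=> mA mD mf AD0; rewrite integral_mkcondr; apply: ae_eq_integral => //.
  by apply/measurable_restrict => //; apply: measurable_funS mf.
exists (A `\` D); split=> //; first exact: measurableD.
move=> x /= H; apply: contrapT => nAD; apply: H => Ax.
have Dx : D x by apply: contrapT => nDx; apply: nAD.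
by rewrite patchT // inE.
Qed.

Section Kusuoka.
Variables (R : realType) (N : nat) (F : ifs R N) (S : form_data R N).
Hypotheses (nf : nested_fractal F) (hs : harmonic_structure F S).
Local Notation pt := 'rV[R]_N.
Local Notation bpt := (borel R N).
Local Notation M := (nmaps F).
Local Notation phi := (@maps R N F).
Local Notation K := (attractor F).
Local Notation rho := (renormalization S).
Local Notation form0 := (form0 F S).
Local Notation energy := (level_energy F S).
Implicit Types (x y z : pt) (w u v : seq 'I_M) (m k : nat) (f g h : pt -> R).

Hypothesis cinj : forall w v : seq 'I_M, size w = size v -> cell w = cell v -> w = v.

Lemma word_unique w x : cell w x -> ~ Vinf F x -> word F (size w) x = w.
Proof.
move=> xw nx; apply: contrapT => /nesym H; apply: nx.
have [sv xv] := wordP nf (size w) (cell_sub nf xw).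
have [[p Vp wp] _] := cell_meet nf cinj (esym sv) H xw xv.
by exists (size w) => //; apply/VlevP; exists w => //; exists p.
Qed.

Lemma measurable_cell w : measurable (cell w : set bpt).
Proof. by apply: measurable_closed; exact: cell_closed. Qed.

Lemma measurable_Vinf : measurable (Vinf F : set bpt).
Proof. by apply: measurable_countable; exact: Vinf_countable. Qed.

(** A function of the level-m word is constant on the interiors of finitely
    many cells; on the countable set of vertices it may be anything. *)
Lemma measurable_word d (T : measurableType d) (A : set bpt) (f : seq 'I_M -> T) m :
  measurable A -> A `<=` K -> measurable_fun A (fun x => f (word F m x)).
Proof.
move=> mA AK _ Y mY.
have -> : A `&` (fun x => f (word F m x)) @^-1` Y =
    (\bigcup_(t in [set t : m.-tuple 'I_M | Y (f t)]) (A `&` (cell t `\` Vinf F)))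
    `|` ((A `&` (fun x => f (word F m x)) @^-1` Y) `&` Vinf F).
  apply/seteqP; split=> [x [Ax Yx]|x [[t /= Yt [Ax [xt nx]]]|[]//]].
    have [Vx|nx] := pselect (Vinf F x); [by right|left].
    have [sx xx] := wordP nf m (AK _ Ax).
    by exists (Tuple (introT eqP sx)).
  split=> //=; have := word_unique xt nx.
  by rewrite size_tuple => ->.
apply: measurableU.
  apply: fin_bigcup_measurable => [|t _]; first exact: finite_finset.
  apply: measurableI => //; apply: measurableD; first exact: measurable_cell.
  exact: measurable_Vinf.
apply: measurable_countable; apply: sub_countable (Vinf_countable nf).
by apply: subset_card_le => x [].
Qed.

Variables (n : nat) (e : 'I_n -> pt -> R).
Hypothesis he : orthonormal_basis F S e.
Hypothesis nd : nondegenerate_structure F S.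
Variables (nu : {measure set bpt -> \bar R}) (Z : pt -> 'M[R]_n).
Hypothesis hnu : kusuoka_measure F S e nu.
Hypothesis hZ : kusuoka_density F S e nu Z.

Lemma nu_Vinf : nu (Vinf F) = 0%E.
Proof. by apply: countable_null; [case: hnu|exact: Vinf_countable]. Qed.

(** Off the vertices and the exceptional set of the convergence of Z_m, addresses
    are unique and Z is a genuine limit, hence a positive matrix. *)
Lemma good_set : exists D : set bpt, [/\ measurable D, D `<=` K `\` Vinf F,
  nu (K `\` D) = 0%E & forall x, D x -> forall i j,
    (fun m => Zlev F S e m x i j) @ \oo --> Z x i j].
Proof.
have [_ [B [mB B0 sB]]] := hZ.
have mK : measurable (K : set bpt) by apply: measurable_closed; exact: attractor_closed.
exists (K `\` (Vinf F `|` B)); split.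
- by apply: measurableD => //; apply: measurableU => //; exact: measurable_Vinf.
- by move=> x [Kx nx]; split=> // Vx; apply: nx; left.
- rewrite setDD; apply/eqP; rewrite -measure_le0.
  apply: (@le_trans _ _ (nu (Vinf F `|` B))).
    apply: le_measure; rewrite ?inE.
    - by apply: measurableI => //; apply: measurableU => //; exact: measurable_Vinf.
    - by apply: measurableU => //; exact: measurable_Vinf.
    - exact: subIsetr.
  have nuB : nu B = 0%E := B0.
  have H : (nu (Vinf F `|` B) <= nu (Vinf F) + nu B)%E.
    exact: (measureU2 nu measurable_Vinf mB).
  by rewrite nuB nu_Vinf adde0 in H.
- move=> x [Kx nx]; apply: contrapT => nH; apply: (nx); right; apply: sB => H.
  by apply: nH; apply: H; split=> // Vx; apply: nx; left.
Qed.

Section GoodSet.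
Variable D : set bpt.
Hypotheses (mD : measurable D) (DK : D `<=` K `\` Vinf F) (Dnull : nu (K `\` D) = 0%E).
Hypothesis Zlim : forall x, D x -> forall i j,
  (fun m => Zlev F S e m x i j) @ \oo --> Z x i j.

Definition dcell w : set bpt := cell w `&` D.

Lemma measurable_dcell w : measurable (dcell w).
Proof. by apply: measurableI => //; exact: measurable_cell. Qed.

Lemma dcell_sub w : dcell w `<=` K.
Proof. by move=> x [_ /DK[]]. Qed.

Lemma dcell_word w x : dcell w x -> word F (size w) x = w.
Proof. by move=> [xw /DK[_ nx]]; exact: word_unique. Qed.

Lemma nu_dcell w : nu (dcell w) = (rho ^+ size w * \tr (Gram S e w))%:E.
Proof.
have [_ _ <-] := hnu.
have -> : nu (cell w) = (nu (cell w `\` D) + nu (dcell w))%E.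
  exact: (measureDI nu (measurable_cell w) mD).
suff -> : nu (cell w `\` D) = 0%E by rewrite add0e.
apply/eqP; rewrite -measure_le0 -Dnull; apply: le_measure; rewrite ?inE.
- by apply: measurableD => //; exact: measurable_cell.
- by apply: measurableD => //; apply: measurable_closed; exact: attractor_closed.
- by move=> x [/(cell_sub nf) Kx nDx].
Qed.

(** Subcells overlap in vertices only, and these are not in D. *)
Lemma dcell_split w (f : bpt -> \bar R) : measurable_fun (dcell w) f ->
  (forall x, dcell w x -> (0 <= f x)%E) ->
  (\int[nu]_(x in dcell w) f x = \sum_i \int[nu]_(x in dcell (rcons w i)) f x)%E.
Proof.
have E : dcell w = \big[setU/set0]_(i <- index_enum 'I_M) dcell (rcons w i).
  rewrite -bigcup_seq; apply/seteqP; split=> x.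
    move=> [/(cell_rconsP nf)[i xi] Dx]; exists i => //=.
    by rewrite mem_index_enum.
  by move=> [i _ [xi Dx]]; split=> //; apply/(cell_rconsP nf); exists i.
rewrite E => mf f0; apply: ge0_integral_bigsetU => //.
- by move=> i; exact: measurable_dcell.
- exact: index_enum_uniq.
- move=> i j _ _ [x [xi xj]].
  have := dcell_word xi; have := dcell_word xj; rewrite !size_rcons => -> /rcons_inj.
  by case.
Qed.

Lemma measurable_qform_word (A : set bpt) (V : seq 'I_M -> 'cV[R]_n) m :
  measurable A -> A `<=` K -> measurable_fun A (fun x => qform (Z x) (V (word F m x))).
Proof.
move=> mA AK; apply: measurable_qform => [i j|i]; last first.
  exact: (measurable_word (fun w => V w i 0)).
have [mZ _] := hZ; apply: measurable_funS (mZ i j) => //.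
by apply: measurable_closed; exact: attractor_closed.
Qed.

Lemma qform_Zlev_ge0 m x a : 0 <= qform (Zlev F S e m x) a.
Proof.
rewrite /Zlev qformZ mulr_ge0 ?(qform_Gram_ge0 S) //.
by rewrite invr_ge0; exact: (trace_Gram_ge0 S).
Qed.

(** Z_m has trace 1, or vanishes when the Gram matrix does. *)
Lemma qform_Zlev_le m x a : qform (Zlev F S e m x) a <= mass a.
Proof.
rewrite /Zlev qformZ; set t := \tr _; have t0 : 0 <= t by exact: (trace_Gram_ge0 S).
have M0 : 0 <= mass a by rewrite /mass mulr_ge0 // sqr_ge0.
move: t0; rewrite le_eqVlt => /predU1P[<-|t0]; first by rewrite invr0 mul0r.
by rewrite ler_pdivrMl //; exact: (qform_Gram_le S).
Qed.

Lemma qform_Z_ge0 x a : D x -> 0 <= qform (Z x) a.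
Proof.
move=> Dx; have cv := (@cvg_qform _ _ _ _ a (Zlim Dx)).
rewrite -(cvg_lim (@Rhausdorff R) cv); apply: limr_ge.
  by apply/cvg_ex; exists (qform (Z x) a).
by apply: nearW => m; exact: qform_Zlev_ge0.
Qed.

(** At level |w| the density is constant on the cell and the measure cancels the
    trace; passing to deeper levels uses the additivity of Gram matrices. *)
Lemma integral_Zlev k w a : (\int[nu]_(x in dcell w)
  (qform (Zlev F S e (size w + k) x) a)%:E = (rho ^+ size w * qform (Gram S e w) a)%:E)%E.
Proof.
have mZl m v : measurable_fun (dcell v) (fun x : bpt => (qform (Zlev F S e m x) a)%:E).
  apply/measurable_EFinP.
  apply: (measurable_word (fun w => qform ((\tr (Gram S e w))^-1 *: Gram S e w) a)).
    exact: measurable_dcell.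
  exact: dcell_sub.
elim: k w => [|k IH] w.
  rewrite addn0.
  under eq_integral => x /set_mem xw do rewrite /Zlev (dcell_word xw).
  rewrite integral_cst; last exact: measurable_dcell.
  rewrite nu_dcell -EFinM; congr EFin; rewrite qformZ.
  set t := \tr _; have [t0|t0] := eqVneq t 0; last by field.
  rewrite t0 mulr0 mulr0; apply/esym/eqP; rewrite mulf_eq0; apply/orP; right.
  rewrite eq_le (qform_Gram_ge0 S) andbT.
  by have := qform_Gram_le S e w a; rewrite -/t t0 mul0r.
rewrite dcell_split; [|exact: mZl|by move=> x _; rewrite lee_fin qform_Zlev_ge0].
under eq_bigr => i _ do rewrite addnS -addSn -(size_rcons w i) IH size_rcons.
rewrite sumEFin; congr EFin.
rewrite (Gram_rcons nf hs cinj he w) qformZ qform_sum -mulr_sumr.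
by rewrite exprSr -mulrA.
Qed.

(** The densities Z_m are bounded and converge to Z, and their integrals over a
    cell do not depend on m: this is the martingale property behind the
    existence of the limit. *)
Lemma integral_Z w a : (\int[nu]_(x in dcell w)
  (qform (Z x) a)%:E = (rho ^+ size w * qform (Gram S e w) a)%:E)%E.
Proof.
have mw := measurable_dcell w.
have [|||||_ _ H] := @dominated_convergence _ _ _ nu (dcell w) mw
  (fun m x => (qform (Zlev F S e (size w + m) x) a)%:E)
  (fun x => (qform (Z x) a)%:E) (cst (mass a)%:E).
- move=> m; apply/measurable_EFinP.
  apply: (measurable_word (fun w => qform ((\tr (Gram S e w))^-1 *: Gram S e w) a)) => //.
  exact: dcell_sub.
- apply/measurable_EFinP.
  apply: (measurable_qform_word (fun _ => a) 0) => //; exact: dcell_sub.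
- apply: aeW => x [_ Dx]; apply: cvg_EFin; first exact: nearW.
  have := (@cvg_qform _ _ _ _ a (Zlim Dx)).
  rewrite -(cvg_shiftn (size w)) /=; apply: cvg_trans.
  by apply: near_eq_cvg; apply: nearW => m /=; rewrite addnC.
- apply/integrableP; split; first exact: measurable_cst.
  apply: (@le_lt_trans _ _ ((`|mass a|)%:E * nu (dcell w))%E).
    by rewrite -(integral_cst nu mw); exact: lexx.
  by rewrite nu_dcell -EFinM ltry.
- apply: aeW => x m _; rewrite lee_fin ger0_norm ?qform_Zlev_ge0 //.
  exact: qform_Zlev_le.
have {}H : (fun m : nat => (rho ^+ size w * qform (Gram S e w) a)%:E) @ \oo
    --> (\int[nu]_(x in dcell w) (qform (Z x) a)%:E)%E.
  apply: cvg_trans H; apply: near_eq_cvg; apply: nearW => m /=.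
  by rewrite integral_Zlev.
apply: esym; rewrite -(cvg_lim (@ereal_hausdorff R) H).
by rewrite lim_cst //; exact: ereal_hausdorff.
Qed.

Variable f : pt -> R.
Local Notation grad_lev := (grad_lev F S e).

(** At level |w| the gradient is a constant vector on the cell, so that integral_Z
    applies; deeper levels follow by splitting the cell. *)
Lemma integral_grad_lev k w : (\int[nu]_(x in dcell w)
  (qform (Z x) (grad_lev (size w + k) f x))%:E =
  (rho ^+ size w * energy k (f \o phiw w) (f \o phiw w))%:E)%E.
Proof.
elim: k w => [|k IH] w.
  rewrite addn0.
  under eq_integral => x /set_mem xw do rewrite /Defs.grad_lev (dcell_word xw).
  by rewrite integral_Z (qform_gradient nf hs cinj he).
rewrite dcell_split; first last.
- by move=> x [_ Dx]; rewrite lee_fin qform_Z_ge0.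
- apply/measurable_EFinP.
  apply: (measurable_qform_word (fun w => invmx (Mmx S e w) *m
    coords F S e (Ptilde F S (Hext F S (f \o phiw w)))));
    [exact: measurable_dcell|exact: dcell_sub].
under eq_bigr => i _ do rewrite addnS -addSn -(size_rcons w i) IH size_rcons phiw_rconsE.
by rewrite sumEFin; congr EFin; rewrite -mulr_sumr exprSr -mulrA.
Qed.

Variable G : pt -> 'cV[R]_n.
Hypothesis hG : is_gradient F S e nu Z f G.

Lemma measurable_qform_gradient (A : set bpt) : measurable A -> A `<=` K ->
  measurable_fun A (fun x => qform (Z x) (G x)).
Proof.
have mK : measurable (K : set bpt) by apply: measurable_closed; exact: attractor_closed.
have [mZ _] := hZ; have [mG _] := hG.
move=> mA AK; apply: measurable_qform => [i j|i].
  by apply: measurable_funS (mZ i j).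
by apply: measurable_funS (mG i).
Qed.

(** By monotonicity the energy at level k is at most the energy at any deeper
    level j, which is the integral of the square of a level gradient. The latter
    differs from G by an amount that vanishes as j grows; the factor 2 comes from
    comparing a quadratic form at two vectors. *)
Lemma energy_le_integral k w :
  ((rho ^+ size w * energy k (f \o phiw w) (f \o phiw w))%:E <=
   2%:E * \int[nu]_(x in dcell w) (qform (Z x) (G x))%:E)%E.
Proof.
have mK : measurable (K : set bpt) by apply: measurable_closed; exact: attractor_closed.
have mw := measurable_dcell w; have [mG cG] := hG; have [mZ _] := hZ.
set I := (\int[nu]_(x in dcell w) _)%E.
have mdiff m (A : set bpt) : measurable A -> A `<=` K ->
    measurable_fun A (fun x : bpt => (qform (Z x) (grad_lev m f x - G x))%:E).
  move=> mA AK; apply/measurable_EFinP; apply: measurable_qform => [i j|i].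
    by apply: measurable_funS (mZ i j).
  under eq_fun do rewrite mxE [X in _ + X]mxE.
  apply: measurable_funB; last by apply: measurable_funS (mG i).
  exact: (measurable_word (fun w => (invmx (Mmx S e w) *m
    coords F S e (Ptilde F S (Hext F S (f \o phiw w)))) i 0)).
pose E m := (\int[nu]_(x in D) (qform (Z x) (grad_lev m f x - G x))%:E)%E.
have Knull : K `&` D = D by apply/seteqP; split=> [x []|x Dx] //; split=> //; case: (DK Dx).
have DsK : D `<=` K by rewrite -Knull => x [].
have cE : (fun m => (E m `^ 2^-1)%E) @ \oo --> 0%E.
  apply: cvg_trans cG; apply: near_eq_cvg; apply: nearW => m.
  rewrite /energy_seminorm (integral_full_subset mK mD) ?Knull //.
  exact: mdiff.
have E0 m : (0 <= E m)%E.
  by apply: integral_ge0 => x Dx; rewrite lee_fin qform_Z_ge0.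
have bound j : (k <= j)%N ->
    ((rho ^+ size w * energy k (f \o phiw w) (f \o phiw w))%:E <=
     2%:E * I + 2%:E * E (size w + j)%N)%E.
  move=> kj; apply: (@le_trans _ _
      (rho ^+ size w * energy j (f \o phiw w) (f \o phiw w))%:E).
    by rewrite lee_fin ler_pM2l ?exprn_gt0 ?(rho_gt0 hs) // energy_mono.
  rewrite -integral_grad_lev.
  have mqG : measurable_fun (dcell w) (fun x : bpt => (qform (Z x) (G x))%:E).
    by apply/measurable_EFinP; apply: measurable_qform_gradient => //; exact: dcell_sub.
  have mqd := mdiff (size w + j)%N _ mw (@dcell_sub w).
  apply: (@le_trans _ _ (\int[nu]_(x in dcell w) (2%:E * (qform (Z x) (G x))%:E +
      2%:E * (qform (Z x) (grad_lev (size w + j) f x - G x))%:E))%E).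
    apply: ge0_le_integral => //.
    - by move=> x [_ Dx]; rewrite lee_fin qform_Z_ge0.
    - apply/measurable_EFinP.
      apply: (measurable_qform_word (fun w => invmx (Mmx S e w) *m
        coords F S e (Ptilde F S (Hext F S (f \o phiw w))))) => //.
      exact: dcell_sub.
    - by apply: emeasurable_funD; apply: emeasurable_funM => //; exact: measurable_cst.
    - move=> x [_ Dx]; rewrite -!EFinM -EFinD lee_fin.
      by apply: qform_le => c; exact: qform_Z_ge0.
  rewrite ge0_integralD //; first last.
  - by apply: emeasurable_funM => //; exact: measurable_cst.
  - by move=> x [_ Dx]; rewrite -EFinM lee_fin mulr_ge0 // qform_Z_ge0.
  - by apply: emeasurable_funM => //; exact: measurable_cst.
  - by move=> x [_ Dx]; rewrite -EFinM lee_fin mulr_ge0 // qform_Z_ge0.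
  rewrite !ge0_integralZl ?lee_fin //; first last.
  - by move=> x [_ Dx]; rewrite lee_fin qform_Z_ge0.
  - by move=> x [_ Dx]; rewrite lee_fin qform_Z_ge0.
  apply: leeD2l; rewrite lee_pmul2l // /E; apply: ge0_subset_integral => //.
  - exact: mdiff.
  - by move=> x Dx; rewrite lee_fin qform_Z_ge0.
  - by move=> x [].
apply/lee_addgt0Pr => t t0.
pose q := Num.sqrt (t / 2).
have q0 : 0 < q by rewrite sqrtr_gt0 divr_gt0.
have [m0 _ Hm] := cE _ (nbhs_open_ereal_lt (r := 0) (f := fun=> q) q0).
have mlarge : (m0 <= size w + (k + m0))%N by rewrite addnA leq_addl.
have Eq : (E (size w + (k + m0))%N <= (t / 2)%:E)%E.
  rewrite leNgt; apply/negP => tE.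
  have := Hm _ mlarge; rewrite /= ltNge => /negP; apply.
  have -> : q%:E = ((t / 2)%:E `^ 2^-1)%E by rewrite poweR_EFin powR12_sqrt // divr_ge0 // ltW.
  apply: gt0_ler_poweR; rewrite ?invr_ge0 ?in_itv /= ?leey ?andbT ?E0 ?ltW //.
  by rewrite lte_fin divr_gt0.
apply: le_trans (bound _ (leq_addr m0 k)) _; apply: leeD2l.
apply: (@le_trans _ _ (2%:E * (t / 2)%:E)%E).
  by rewrite lee_pmul2l.
by rewrite -EFinM lee_fin mulrC divfK.
Qed.

End GoodSet.
End Kusuoka.

(** * Balls and cells *)

Section Geometry.
Variables (R : realType) (N : nat) (F : ifs R N).
Hypothesis nf : nested_fractal F.
Local Notation pt := 'rV[R]_N.
Local Notation M := (nmaps F).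
Local Notation L := (scale F).
Local Notation phi := (@maps R N F).
Local Notation K := (attractor F).
Implicit Types (x y z : pt) (w u v : seq 'I_M) (m : nat).

Hypothesis cinj : forall w v : seq 'I_M, size w = size v -> cell w = cell v -> w = v.

Lemma starP m w y : size w = m -> star F m (cell w) y <->
  exists v : seq 'I_M, [/\ size v = m, cell v y & cell v `&` cell w !=set0].
Proof.
move=> sw; split=> [[yw|[_ [[v /= sv <-] meet] yv]]|[v [sv yv meet]]].
- by exists w; split=> //; exists y.
- by exists v.
- by right; exists (cell v) => //; split=> //; exists v.
Qed.

(** If phi i x is a vertex, then either its address starts with i and x is a
    vertex as well, or it lies in two cells of level 1 and x is in V0. *)
Lemma maps_not_Vinf i x : K x -> ~ Vinf F x -> ~ Vinf F (phi i x).
Proof.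
move=> Kx nx Vx.
have [j [z [Vz jz]]] : exists j z, Vinf F z /\ phi j z = phi i x.
  have [[|m] _ /=] := Vx.
    move=> Vix; have [j [jx _]] := Vix.
    by exists j, (phi i x); split=> //; exists 0%N.
  by move=> [j _ [z Vz jz]]; exists j, z; split=> //; exists m.
have Kz : K z.
  have [m _ /VlevP[w _ [p Vp <-]]] := Vz.
  by apply: (phiw_attractor nf); exact: V0_attractor.
have [ij|/eqP ij] := eqVneq i j.
  by apply: nx; rewrite -ij in jz; rewrite -(maps_inj nf jz).
have [|||[p Vp px] _] := @cell_meet _ _ _ nf cinj [:: i] [:: j] (phi i x) erefl.
- by move=> [].
- by exists x.
- by exists z.
by apply: nx; exists 0%N => //=; rewrite -(maps_inj nf px).
Qed.

Variable alpha : R.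
Hypothesis alpha_gt0 : 0 < alpha.
Hypothesis separation : forall n x y, (1 <= n)%N ->
  (K `\` Vinf F) x -> (K `\` Vinf F) y ->
  (star F n (Delta F n x) `\` star F n.+1 (Delta F n.+1 x)) y ->
  alpha * L ^- n <= dist x y.

(** The separation property at level 0 follows from level 1 by moving both
    points into one 1-cell. *)
Lemma separation0 x y : (K `\` Vinf F) x -> (K `\` Vinf F) y ->
  ~ star F 1 (Delta F 1 x) y -> alpha <= dist x y.
Proof.
move=> [Kx nx] [Ky ny] nst; have [i _] := attractor_maps nf Kx.
have gx : (K `\` Vinf F) (phi i x).
  by split; [exact: maps_attractor|exact: maps_not_Vinf].
have gy : (K `\` Vinf F) (phi i y).
  by split; [exact: maps_attractor|exact: maps_not_Vinf].
have w2 z : K z -> ~ Vinf F (phi i z) -> word F 2 (phi i z) = i :: word F 1 z.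
  move=> Kz nz; have [sz zz] := wordP nf 1 Kz.
  have -> : 2%N = size (i :: word F 1 z) by rewrite /= sz.
  apply: (word_unique nf cinj) => //; case: zz => a Ka az.
  by exists a => //=; rewrite az.
have w1 : word F 1 (phi i x) = [:: i].
  by apply: (word_unique nf cinj (w := [:: i])); [exists x|case: gx].
have := separation (leqnn 1) gx gy.
rewrite (nf_similitude nf) mulrC ler_pM2l ?invr_gt0 ?(scale_gt0 nf) //; apply; split.
  by left; rewrite /Delta w1; exists y.
have s2 : size (word F 2 (phi i x)) = 2%N by apply: size_word => //; case: gx.
move=> /(starP _ s2)[v [sv yv [z []]]].
have <- : word F 2 (phi i y) = v by rewrite -sv; apply: (word_unique nf cinj) => //; case: gy.
rewrite !w2 //; [|by case: gx|by case: gy].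
move=> [a Ka /= az] [b Kb /= bz]; apply: nst; apply/starP; first exact: size_word.
exists (word F 1 y); split; [exact: size_word|exact: word_cell|].
exists (phiw (word F 1 y) a); split; first by exists a.
by exists b => //; apply: (maps_inj nf (i := i)); rewrite bz az.
Qed.

(** Induction on n: a point of the star of level n + 1 outside the next one is
    too far away. *)
Lemma near_star n x y : (K `\` Vinf F) x -> (K `\` Vinf F) y ->
  dist x y < alpha * L ^- n -> star F n.+1 (Delta F n.+1 x) y.
Proof.
move=> gx gy; elim: n => [|n IH] xy; apply: contrapT => nst.
  have := separation0 gx gy nst; rewrite leNgt.
  by move: xy; rewrite expr0 invr1 mulr1 => ->.
have xyn : dist x y < alpha * L ^- n.
  apply: lt_le_trans xy _; rewrite ler_pM2l // lef_pV2 ?posrE ?exprn_gt0 ?(scale_gt0 nf) //.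
  by rewrite exprS ler_peMl ?exprn_ge0 ?(ltW (scale_gt0 nf)) // ltW // nf_scale.
have := separation (ltn0Sn n) gx gy (conj (IH xyn) nst).
by rewrite leNgt xy.
Qed.

(** The level is the least m with L ^- m <= r / alpha. If it is 0, the only cell
    is K; otherwise r < alpha * L ^- (m - 1) and near_star applies. *)
Lemma ball_cells x r : (K `\` Vinf F) x -> 0 < r -> exists m, L ^- m <= r / alpha /\
  forall y, eball F x r y -> ~ Vinf F y -> exists w v : seq 'I_M,
    [/\ size w = m /\ size v = m, cell w x, cell v y, cell w `&` cell v !=set0 &
        cell w `|` cell v `<=` eball F x ((1 + 2 / alpha) * r)].
Proof.
move=> [Kx nx] r0.
have big t : t <= 2 * (r / alpha) -> t <= (1 + 2 / alpha) * r.
  move=> tr; apply: le_trans tr _.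
  have -> : (1 + 2 / alpha) * r = r + 2 * (r / alpha) by ring.
  by rewrite lerDr ltW.
(* Large radii: the whole of K is one cell. *)
have [ra|ra] := leP alpha r.
  have ra1 : 1 <= r / alpha by rewrite ler_pdivlMr // mul1r.
  exists 0%N; split; first by rewrite expr0 invr1.
  move=> y [Ky _] _; exists [::], [::]; rewrite cell_nil setIid setUid; split=> //.
    by exists x.
  move=> z Kz; split=> //; apply: big.
  by apply: le_trans (attractor_dist_le1 nf Kx Kz) _; lra.
have exm : exists m, L ^- m <= r / alpha.
  have [m Hm] := small_scaleX nf (divr_gt0 r0 alpha_gt0).
  by exists m; exact: ltW.
case: (ex_minnP exm) => -[|n] Ln min.
  move: Ln; rewrite expr0 invr1 ler_pdivlMr // mul1r => ar.
  by move: (le_lt_trans ar ra); rewrite ltxx.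
exists n.+1; split=> // y [Ky xy] ny.
have rn : r < alpha * L ^- n.
  rewrite mulrC -ltr_pdivrMr // ltNge; apply/negP => /min.
  by rewrite ltnn.
have := near_star (conj Kx nx) (conj Ky ny) (le_lt_trans xy rn).
have sx := size_word nf n.+1 Kx.
move=> /(starP _ sx)[v [sv yv [z [zv zw]]]].
have xw := word_cell nf n.+1 Kx.
exists (word F n.+1 x), v; split=> //; first by exists z.
move=> t tc; split; first by case: tc => /(cell_sub nf).
apply: big.
have Lr : 0 <= r / alpha by rewrite divr_ge0 // ltW.
have xz : dist x z <= r / alpha.
  by apply: le_trans Ln; rewrite -sx; exact: (cell_dist_le nf).
have zt : dist z t <= r / alpha.
  apply: le_trans Ln; case: tc => tc; first by rewrite -sx; exact: (cell_dist_le nf).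
  by rewrite -sv; exact: (cell_dist_le nf).
have Lr2 : 0 <= 2 * (r / alpha) by rewrite mulr_ge0.
rewrite -(ler_pXn2r (ltn0Sn 1)) ?nnegrE ?dist_ge0 //.
apply: le_trans (dist_quasi_triangle x z t) _; rewrite exprMn.
have h1 : dist x z ^+ 2 <= (r / alpha) ^+ 2 by rewrite ler_pXn2r ?nnegrE ?dist_ge0.
have h2 : dist z t ^+ 2 <= (r / alpha) ^+ 2 by rewrite ler_pXn2r ?nnegrE ?dist_ge0.
by lra.
Qed.

End Geometry.

(** * The inequality *)

(** The mean of f over B is itself within t of c. The null set E accounts for the
    vertices, off which the geometric estimates hold. *)
Lemma mean_oscillation d (T : measurableType d) (R : realType)
    (mu : {measure set T -> \bar R}) (B E : set T) (f : T -> R) (c t : R) :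
  measurable B -> measurable E -> mu E = 0%E -> (mu B < +oo)%E ->
  measurable_fun B f -> 0 <= t ->
  (forall y, B y -> ~ E y -> `|f y - c| <= t) ->
  (((fine (mu B))^-1)%:E * \int[mu]_(y in B)
     (`|f y - (fine (mu B))^-1 * (\int[mu]_(y in B) f y)%R|)%:E <= (2 * t)%:E)%E.
Proof.
move=> mB mE E0 Bfin mf t0 ft; set b := fine (mu B); set a := (b^-1 * _)%R.
have [b0|b0] := eqVneq b 0; first by rewrite b0 invr0 mul0e lee_fin mulr_ge0.
have bE : mu B = b%:E by rewrite fineK // ge0_fin_numE.
have bgt0 : 0 < b by rewrite lt_neqAle eq_sym b0 /= -lee_fin -bE.
have mEc : measurable (~` E) by exact: measurableC.
pose B' := B `&` ~` E; have mB' : measurable B' by exact: measurableI.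
have BE0 : mu (B `\` ~` E) = 0%E.
  apply/eqP; rewrite -measure_le0 -E0; apply: le_measure; rewrite ?inE //.
    exact: measurableD.
  by move=> x [_ /contrapT].
have muB' : mu B' = b%:E.
  rewrite -bE; have -> : mu B = (mu (B `\` ~` E) + mu B')%E by exact: measureDI.
  by rewrite BE0 add0e.
have restrict g : measurable_fun B g ->
    (\int[mu]_(x in B) g x = \int[mu]_(x in B') g x)%E.
  by move=> mg; exact: integral_full_subset.
have mf' : measurable_fun B' f by apply: measurable_funS mf => // x [].
have intf : mu.-integrable B' (EFin \o f).
  apply: measurable_bounded_integrable => //; first by rewrite [X in (X < _)%E]muB' ltry.
  exists (`|c| + t); split; first by rewrite num_real.
  move=> u cu y [By nEy]; apply: le_trans (ltW cu).
  rewrite -[f y](subrK c) addrC; apply: le_trans (ler_normD _ _) _.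
  by rewrite lerD2l; apply: ft.
have intc : mu.-integrable B' (EFin \o cst c).
  by apply: measurable_bounded_integrable => //; [rewrite [X in (X < _)%E]muB' ltry|
    exists `|c|; split; [rewrite num_real|move=> u cu y _; exact: ltW]].
have af : a = b^-1 * (\int[mu]_(y in B') f y)%R.
  by rewrite /a /Rintegral restrict //; apply/measurable_EFinP.
have ac : `|a - c| <= t.
  have -> : a - c = b^-1 * (\int[mu]_(y in B') (f y - c))%R.
    rewrite RintegralB // Rintegral_cst // [fine _](_ : _ = b); last by rewrite [mu _]muB'.
    by rewrite af; field.
  rewrite normrM gtr0_norm ?invr_gt0 // ler_pdivrMl //.
  have int_fc : mu.-integrable B' (EFin \o (fun y => f y - c)).
    exact: (integrableB mB' intf intc).
  apply: le_trans (le_normr_Rintegral mB' int_fc) _.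
  rewrite -lee_fin /Rintegral fineK; last first.
    apply: integrable_fin_num => //; exact: (integrable_norm int_fc).
  rewrite EFinM muleC -[b%:E]muB' -(integral_cst mu mB' t%:E).
  apply: ge0_le_integral => //.
  - apply/measurable_EFinP; apply: measurableT_comp => //.
    by apply: measurable_funB => //; exact: measurable_cst.
  - by move=> y [By nEy]; rewrite lee_fin; exact: ft.
rewrite restrict; last first.
  apply/measurable_EFinP; apply: measurableT_comp => //.
  by apply: measurable_funB => //; exact: measurable_cst.
apply: (@le_trans _ _ ((b^-1)%:E * \int[mu]_(y in B') cst (2 * t)%:E y)%E).
  rewrite lee_pmul2l // ?lte_fin ?invr_gt0 //; apply: ge0_le_integral => //.
  - apply/measurable_EFinP; apply: measurableT_comp => //.
    by apply: measurable_funB => //; exact: measurable_cst.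
  - move=> y [By nEy]; rewrite lee_fin; apply: le_trans (ler_distD c _ _) _.
    by rewrite [`|c - a|]distrC; have := ft y By nEy; lra.
rewrite (integral_cst mu mB') [mu B']muB' -!EFinM lee_fin.
by rewrite mulrCA mulVf // mulr1.
Qed.

Section Scaling.
Variables (R : realType) (N : nat) (F : ifs R N) (S : form_data R N).
Hypotheses (nf : nested_fractal F) (hs : harmonic_structure F S).
Local Notation pt := 'rV[R]_N.
Local Notation L := (scale F).
Local Notation K := (attractor F).
Local Notation rho := (renormalization S).

Definition codim : R := ln rho / ln L.

Lemma walk_dimE : walk_dim F S = hdim F + codim.
Proof.
rewrite /walk_dim lnM ?mulrDl // posrE; last exact: (rho_gt0 hs).
exact: lt_trans (nmaps_gt1 nf).
Qed.

Lemma codim_gt0 : 0 < codim.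
Proof. by rewrite divr_gt0 ?(lnscale_gt0 nf) // ln_gt0 // (hs_rho hs). Qed.

Lemma rho_powR m : rho ^- m = (L ^- m) `^ codim.
Proof.
have Lrho : L `^ codim = rho.
  apply: ln_inj; rewrite ?posrE ?powR_gt0 ?(scale_gt0 nf) ?(rho_gt0 hs) //.
  by rewrite ln_powR divfK // gt_eqF // (lnscale_gt0 nf).
rewrite -[L ^+ m]powR_mulrn ?(ltW (scale_gt0 nf)) // -powRN -powRrM mulrC powRrM Lrho powRN.
by rewrite powR_mulrn // ltW // (rho_gt0 hs).
Qed.

(** This is where rho = L ^ (d_w - d) turns a level into a power of r. *)
Lemma rho_le m r alpha : 0 < r -> 0 < alpha -> L ^- m <= r / alpha ->
  rho ^- m <= alpha `^ (- codim) * (r `^ walk_dim F S * (r `^ hdim F)^-1).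
Proof.
move=> r0 a0 Lr; rewrite rho_powR -powRN -powRD; last by apply/implyP => _; rewrite gt_eqF.
rewrite walk_dimE [hdim F + _]addrC addrK.
have -> : alpha `^ (- codim) * r `^ codim = (r / alpha) `^ codim.
  have ai0 : 0 <= alpha^-1 by rewrite invr_ge0 ltW.
  rewrite (powRM _ (ltW r0) ai0) mulrC; congr (_ * _).
  by rewrite -powR_inv1 ?(ltW a0) // -powRrM mulN1r.
apply: ge0_ler_powR => //; rewrite ?nnegrE; [exact: ltW codim_gt0| |].
- exact: ltW (scaleX_gt0 nf m).
- by rewrite divr_ge0 // ltW.
Qed.

Lemma measurable_eball x (r : R) : 0 <= r -> measurable (eball F x r : set (borel R N)).
Proof.
move=> r0; have mK : measurable (K : set (borel R N)).
  by apply: measurable_closed; exact: attractor_closed.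
have mc i : measurable_fun (K : set (borel R N)) (fun y : pt => y 0 i).
  apply: measurable_within_continuous; first exact: attractor_closed.
  apply/within_continuous_distP => y Ky u u0; exists u => // z Kz yz.
  apply: le_lt_trans yz; apply: le_trans (norm_le_dist y z).
  by have := coord_le_norm (y - z) i; rewrite !mxE.
have md : measurable_fun (K : set (borel R N)) (fun y : pt => dot (x - y) (x - y)).
  apply: measurable_sum => i; under eq_fun do rewrite mxE [X in _ + X]mxE.
  by apply: measurable_funM; apply: measurable_funB => //; exact: measurable_cst.
have -> : eball F x r = K `&` (fun y : pt => dot (x - y) (x - y)) @^-1` `]-oo, r ^+ 2].
  apply/seteqP; split=> y [Ky xy]; split=> //.
    by rewrite /= in_itv /= -dist_sqr ler_pXn2r ?nnegrE ?dist_ge0.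
  by move: xy; rewrite /= in_itv /= -dist_sqr ler_pXn2r ?nnegrE ?dist_ge0.
exact: md.
Qed.

End Scaling.

Unset Implicit Arguments.
Set Strict Implicit.

Theorem theorem3p5 (R : realType) (N : nat) (F : ifs R N) (S : form_data R N) :
  nested_fractal F -> harmonic_structure F S -> nondegenerate_structure F S ->
  property_P F ->
  exists C A : R, 0 < C /\ 1 <= A /\
  forall (mu nu : {measure set (borel R N) -> \bar R})
    (n : nat) (e : 'I_n -> 'rV[R]_N -> R) (Z : 'rV[R]_N -> 'M[R]_n),
  normalized_hausdorff F mu ->
  orthonormal_basis F S e ->
  kusuoka_measure F S e nu ->
  kusuoka_density F S e nu Z ->
  forall (f : 'rV[R]_N -> R) (gradf : 'rV[R]_N -> 'cV[R]_n),
  dom_form F S f ->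
  is_gradient F S e nu Z f gradf ->
  forall (x0 : 'rV[R]_N) (r : R), (attractor F `\` Vinf F) x0 -> 0 < r ->
  let B : set (borel R N) := eball F x0 r in
  let fB : R := (fine (mu B))^-1 * (\int[mu]_(y in B) f y) in
  (((fine (mu B))^-1)%:E * \int[mu]_(y in B) (`|f y - fB|)%:E <=
   (C * r `^ (walk_dim F S / 2))%:E *
     (((r `^ hdim F)^-1)%:E *
       \int[nu]_(y in eball F x0 (A * r)) (qform (Z y) (gradf y))%:E) `^ 2^-1)%E.
Proof.
move=> nf hs nd [alpha a0 sep].
have [C1 C10 osc] := oscillation nf hs.
set c2 := alpha `^ (- codim F S).
have c20 : 0 < c2 by exact: powR_gt0.
exists (4 * C1 * Num.sqrt (2 * c2)), (1 + 2 / alpha).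
split; first by rewrite !mulr_gt0 // sqrtr_gt0 mulr_gt0.
split; first by rewrite lerDl divr_ge0 // ltW.
move=> mu nu n e Z hmu he hnu hZ f G [cf _] hG x0 r gx r0; cbv zeta.
pose B : set (borel R N) := eball F x0 r; rewrite -/B.
set A := 1 + 2 / alpha; set bA := eball F x0 (A * r).
have cinj := cell_inj nf hmu.
have [D [mD DK D0 Zlim]] := good_set nf hnu hZ.
have Ar0 : 0 <= A * r by rewrite mulr_ge0 ?(ltW r0) // addr_ge0 // divr_ge0 // ltW.
have mbA : measurable (bA : set (borel R N)) by exact: measurable_eball.
have mB : measurable B by apply: measurable_eball => //; exact: ltW.
have mK : measurable (attractor F : set (borel R N)).
  by apply: measurable_closed; exact: attractor_closed.
have bAK : bA `<=` attractor F by move=> y [].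
have mq : measurable_fun (bA : set (borel R N))
    (fun y : borel R N => (qform (Z y) (G y))%:E).
  by apply/measurable_EFinP; exact: (measurable_qform_gradient nf hZ hG).
have qD y : D y -> (0 <= (qform (Z y) (G y))%:E)%E.
  by move=> Dy; rewrite lee_fin; exact: (qform_Z_ge0 (S := S) Zlim).
set I := (\int[nu]_(y in bA) _)%E.
have IE : I = (\int[nu]_(y in bA `&` D) (qform (Z y) (G y))%:E)%E.
  apply: integral_full_subset => //; apply/eqP; rewrite -measure_le0 -D0.
  by apply: le_measure; rewrite ?inE; [exact: measurableD|exact: measurableD|];
    move=> y [/bAK Ky nDy].
have I0 : (0 <= I)%E by rewrite IE; apply: integral_ge0 => y [_ /qD].
have rd0 : 0 < r `^ hdim F by exact: powR_gt0.
have CC0 : 0 < 4 * C1 * Num.sqrt (2 * c2) * r `^ (walk_dim F S / 2).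
  by rewrite !mulr_gt0 ?sqrtr_gt0 ?mulr_gt0 ?powR_gt0.
(* An infinite integral makes the right-hand side infinite. *)
move: I0; case EI : I => [J| |//] J0; last first.
  rewrite gt0_muley ?lte_fin ?invr_gt0 // poweRyr // gt0_muley ?lte_fin //.
  exact: leey.
rewrite lee_fin in J0.
have [m [Lm cells]] := ball_cells nf cinj a0 sep gx r0.
pose E := 2 * (renormalization S ^- m * J).
have rhom : 0 < renormalization S ^+ m by rewrite exprn_gt0 // (rho_gt0 hs).
have E0 : 0 <= E by rewrite mulr_ge0 // mulr_ge0 // invr_ge0 ltW.
have cellE (w : seq 'I_(nmaps F)) : size w = m -> cell w `<=` bA ->
    forall k, level_energy F S k (f \o phiw w) (f \o phiw w) <= E.
  move=> wm wA k.
  have := energy_le_integral nf hs cinj he nd hnu hZ mD DK D0 Zlim hG k w.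
  set X := (\int[nu]_(x in dcell D w) _)%E => H.
  have XJ : (X <= J%:E)%E.
    rewrite -EI IE; apply: ge0_subset_integral.
    - exact: measurable_dcell.
    - exact: measurableI.
    - by apply: measurable_funS mq => // y [].
    - by move=> y [_ /qD].
    - by move=> y [/wA].
  have : ((renormalization S ^+ size w * level_energy F S k (f \o phiw w) (f \o phiw w))%:E
      <= (2 * J)%:E)%E.
    by apply: le_trans H _; rewrite EFinM lee_pmul2l.
  by rewrite lee_fin wm /E mulrCA -ler_pdivlMl.
have cell_osc (w : seq 'I_(nmaps F)) x y : size w = m -> cell w `<=` bA ->
    cell w x -> cell w y -> `|f x - f y| <= C1 * Num.sqrt E.
  move=> wm wA [p Kp <-] [q Kq <-].
  apply: (osc (f \o phiw w)) => //; last exact: cellE.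
  exact: comp_phiw_continuous.
have pointwise y : B y -> ~ Vinf F y -> `|f y - f x0| <= 2 * (C1 * Num.sqrt E).
  move=> By ny; have [w [v [[wm vm] xw yv [z [zw zv]] sub]]] := cells y By ny.
  apply: le_trans (ler_distD (f z) _ _) _; rewrite mulr_natl mulr2n; apply: lerD.
    by apply: (cell_osc v) => // t tv; apply: sub; right.
  by apply: (cell_osc w) => // t tw; apply: sub; left.
have mf : measurable_fun B f.
  have mfK := measurable_within_continuous (attractor_closed nf) cf.
  by apply: measurable_funS mfK => // y [].
have Bfin : (mu B < +oo)%E.
  have [muK _] := hmu; apply: (@le_lt_trans _ _ (mu (attractor F))).
    by apply: le_measure; rewrite ?inE // => y [].
  by rewrite [mu _]muK ltry.
have t0 : 0 <= 2 * (C1 * Num.sqrt E) by rewrite mulr_ge0 // mulr_ge0 ?sqrtr_ge0 // ltW.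
have muV : mu (Vinf F) = 0%E.
  by apply: countable_null; [exact: (mu_set1 nf hmu)|exact: Vinf_countable].
have H := mean_oscillation mB (measurable_Vinf nf) muV Bfin mf t0 pointwise.
apply: le_trans H _.
rewrite -[(_^-1%:E * J%:E)%E]EFinM poweR_EFin -EFinM lee_fin.
rewrite powR12_sqrt; last by rewrite mulr_ge0 // invr_ge0 ltW.
rewrite powRrM powR12_sqrt; last exact: powR_ge0.
have -> : 2 * (2 * (C1 * Num.sqrt E)) = 4 * C1 * Num.sqrt E by ring.
rewrite -!mulrA; apply: ler_wpM2l => //; apply: ler_wpM2l; first exact: ltW.
rewrite -sqrtrM ?powR_ge0 // -sqrtrM; last by rewrite mulr_ge0 // ltW.
apply: ler_wsqrtr; rewrite /E -!mulrA; apply: ler_wpM2l => //.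
have h := ler_wpM2r J0 (rho_le nf hs r0 a0 Lm).
by rewrite -!mulrA in h.
Qed.
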